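(* Let $T>0$, $g\in L^2(\Omega)$, $\delta>0$, $K>0$, $s\in(0,T)$, let $\Lambda$ be the unique positive root of $x=K+x^{s/T}$, and let $\Gamma\subset\rho(-A)$ be a contour $$\Gamma=\{z(y)=\gamma-\sqrt{\nu^2+y^2}+i\sigma y : y \text{ increasing from } -\infty \text{ to } +\infty\},\qquad \operatorname{Re} z(0)=\frac{\log\Lambda}{T},$$ with $\gamma\in\mathbb{R}$, $\nu>0$, $\sigma>0$. Let $u^{\Gamma,u_{10}}$ and $u^{\Gamma,u_{20}}$ be two new regularized solutions, i.e. $u_{10},u_{20}\in L^2(\Omega)$ and, for $j=1,2$, $$\|u_{j0}-g\|\le\delta,\qquad \|u^{\Gamma,u_{j0}}(T)-u^{\Gamma,u_{j0}}(s)\|\le K\delta .$$ Then $$\|u^{\Gamma,u_{10}}(t)-u^{\Gamma,u_{20}}(t)\|\le 2\Lambda^{t/T}\delta\qquad\text{for all }t\in[0,T].$$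
   Context: $\Omega$ is a domain and $\|\cdot\|$ is the $L^2(\Omega)$-norm, with inner product $(\cdot,\cdot)$. $-A$ is a second-order linear uniformly elliptic partial differential operator on $\Omega$ with the homogeneous Dirichlet boundary condition on $\partial\Omega$, self-adjoint in $L^2(\Omega)$, having eigenvalues $0<\lambda_1\le\lambda_2\le\cdots<\infty$ (discrete spectrum, $\lambda_n\to\infty$) with corresponding orthonormal eigenfunctions $\phi_1,\phi_2,\dots$ forming an orthonormal basis of $L^2(\Omega)$. $\rho(-A)$ is the resolvent set of $-A$. For $u_0\in L^2(\Omega)$ define, for $0<t\le T$, $$u^{\Gamma,u_0}(t)=\frac{1}{2\pi i}\int_\Gamma e^{zt}v(z)\,dz,$$ where for each $z\in\Gamma$, $v(z)\in H^1_0(\Omega)$ is the unique solution of $zv+Av=u_0$, i.e. $v(z)=(zI+A)^{-1}u_0$. At $t=0$, $u^{\Gamma,u_0}(0)=\Pi_\Gamma u_0$, where $\Pi_\Gamma$ is the $L^2(\Omega)$-orthogonal projection onto $\Phi_\Gamma=\operatorname{span}\{\phi_1,\dots,\phi_N\}$ and $\lambda_1,\dots,\lambda_N$ are all the eigenvalues (counted with multiplicity) strictly less than $\frac{\log\Lambda}{T}$ (with $\Phi_\Gamma=\{0\}$ if there are none). *)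

(* Defs.v *)
From HB Require Import structures.
From mathcomp Require Import all_boot all_order all_algebra.
From mathcomp Require Import all_classical all_reals all_analysis measurable_realfun.
From mathcomp Require Import complex.

Set Implicit Arguments.
Unset Strict Implicit.
Unset Printing Implicit Defensive.
Import Order.TTheory GRing.Theory Num.Theory.
Import numFieldNormedType.Exports.

Local Open Scope classical_set_scope.
Local Open Scope ring_scope.

(* R^d with its Borel sigma-algebra. *)
Definition Rd (R : realType) (d : nat) := g_sigma_algebraType (@open 'rV[R]_d).

Section Lebesgue.
Context {R : realType}.

Lemma open_measurable_Rd d (U : set (Rd R d)) :
  @open 'rV[R]_d U -> measurable U.
Proof. by move=> oU; apply: sub_sigma_algebra. Qed.

Lemma measurable_coord d (i : 'I_d) : measurable_fun [set: Rd R d]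
  ((fun v : 'rV[R]_d => v ord0 i) : Rd R d -> measurableTypeR R).
Proof.
apply: (measurability _ (RGenOpens.measurableE R)).
move=> _ [_ [a [b ->] <-]]; rewrite setTI; apply: open_measurable_Rd.
apply: (@open_comp 'rV[R]_d R); last exact: interval_open.
by move=> v _; exact: coord_continuous.
Qed.

Definition ratbox d (p : 'rV[rat]_d * nat) : set 'rV[R]_d :=
  [set v | forall i, `|ratr (p.1 ord0 i) - v ord0 i| < p.2.+1%:R^-1].

Lemma open_ratbox d (U : set 'rV[R]_d) : open U ->
  U = \bigcup_(p in [set p | ratbox p `<=` U]) ratbox p.
Proof.
move=> oU; apply/seteqP; split=> [v Uv|v [p /= + vp]]; last exact.
have /nbhs_ballP[e /= e0 veU] : nbhs v U by exact: open_nbhs_nbhs.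
have [n ne] : exists n, n.+1%:R^-1 < e / 2.
  have [n _ /(_ n (leqnn n)) ne] : \forall n \near \oo, n.+1%:R^-1 < e / 2.
    exact: near_infty_natSinv_lt (PosNum (divr_gt0 e0 (ltr0n _ 2))).
  by exists n.
have /choice[q qP] i : exists q : rat, ratr q \in `]v ord0 i - n.+1%:R^-1, v ord0 i[.
  by apply: rat_in_itvoo; rewrite ltrBlDr ltrDl invr_gt0.
have vq : ratbox (\row_i q i, n) v.
  move=> i; rewrite mxE /=; have := qP i; rewrite in_itv /= => /andP[a b].
  by rewrite distrC gtr0_norm ?subr_gt0// ltrBlDr -ltrBlDl.
exists (\row_i q i, n) => //= w /= wq; apply: veU; split => // i j.
rewrite (ord1 i) /ball/=.
have := wq j; have := vq j; rewrite /= => h1 h2.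
rewrite -(subrKA (ratr ((\row_i q i) ord0 j))).
rewrite (le_lt_trans (ler_normD _ _))// [e]splitr ltrD//.
  by rewrite distrC (lt_trans h1).
by rewrite (lt_trans h2).
Qed.

Lemma measurable_fun_Rd dT (T : measurableType dT) d (f : T -> Rd R d) :
  (forall i, measurable_fun [set: T]
     ((fun t => (f t : 'rV[R]_d) ord0 i) : T -> measurableTypeR R)) ->
  measurable_fun [set: T] f.
Proof.
move=> mf; apply: measurability => [|_ [U oU <-]]; first reflexivity.
rewrite setTI (open_ratbox oU) preimage_bigcup bigcup_mkcond.
apply: countable_bigcupT_measurable => [|p]; first exact: countableP.
case: ifPn => // _.
rewrite (_ : _ @^-1` _ = \bigcap_(i in [set: 'I_d])
    ((fun t => (f t : 'rV[R]_d) ord0 i) @^-1`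
       (ball (ratr (p.1 ord0 i) : R) p.2.+1%:R^-1))); last first.
  by apply/seteqP; split=> [t ft i _|t ft i]; [exact: ft|exact: ft].
apply: fin_bigcap_measurable => // i _.
rewrite -[X in measurable X]setTI; apply: mf => //.
by apply: open_measurable; exact: ball_open.
Qed.

Definition consRd d (p : measurableTypeR R * Rd R d) : Rd R d.+1 :=
  row_mx (const_mx p.1 : 'rV_1) (p.2 : 'rV_d) : 'rV[R]_(1 + d).

Definition unconsRd d (v : Rd R d.+1) : measurableTypeR R * Rd R d :=
  ((v : 'rV[R]_(1 + d)) ord0 ord0, rsubmx (v : 'rV[R]_(1 + d))).

Lemma consRdK d : cancel (@consRd d) (@unconsRd d).
Proof.
case=> x v; rewrite /unconsRd /consRd /= row_mxKr; congr pair.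
by rewrite (_ : ord0 = lshift d (ord0 : 'I_1)) ?row_mxEl ?mxE//; exact: val_inj.
Qed.

Lemma measurable_consRd d : measurable_fun [set: _] (@consRd d).
Proof.
apply: measurable_fun_Rd => i; case: (split_ordP (i : 'I_(1 + d))) => j ->.
  rewrite (_ : (fun _ => _) = fst); first exact: measurable_fst.
  by apply/funext => -[x v]; apply: etrans (row_mxEl _ _ _ _) _; rewrite mxE.
rewrite (_ : (fun _ => _) = (fun v : 'rV[R]_d => v ord0 j) \o snd); last first.
  by apply/funext => -[x v]; exact: row_mxEr.
by apply: (measurableT_comp (measurable_coord j)); exact: measurable_snd.
Qed.

Lemma measurable_unconsRd d : measurable_fun [set: _] (@unconsRd d).
Proof.
apply/measurable_fun_pairP; split; first exact: measurable_coord.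
apply: measurable_fun_Rd => i.
rewrite (_ : (fun _ => _) = fun v : 'rV[R]_(1 + d) => v ord0 (rshift 1 i)).
  exact: measurable_coord.
by apply/funext => v /=; rewrite mxE.
Qed.

Section step.
Context d (mu : {sigma_finite_measure set (Rd R d) -> \bar R}).

(* Lebesgue measure on R^(d+1), from a measure mu on R^d. *)
Definition lebS : set (Rd R d.+1) -> \bar R :=
  pushforward (lebesgue_measure \x mu)%E (@consRd d).

Let lebS0 : lebS set0 = 0%E. Proof. by rewrite /lebS /pushforward preimage_set0 measure0. Qed.

Let mpre (A : set (Rd R d.+1)) : measurable A -> measurable (@consRd d @^-1` A).
Proof. by move=> mA; rewrite -[X in measurable X]setTI; exact: measurable_consRd. Qed.

Let lebS_ge0 A : (0 <= lebS A)%E.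
Proof. by rewrite /lebS /pushforward measure_ge0. Qed.

Let lebS_sigma_additive : semi_sigma_additive lebS.
Proof.
move=> F mF tF mUF; rewrite /lebS /pushforward preimage_bigcup.
apply: measure_semi_sigma_additive.
- by move=> n; exact: mpre.
- apply/trivIsetP => /= i j _ _ ij; rewrite -preimage_setI.
  by move/trivIsetP : tF => /(_ _ _ _ _ ij) ->//; rewrite preimage_set0.
- by rewrite -preimage_bigcup; exact: mpre.
Qed.

HB.instance Definition _ :=
  isMeasure.Build _ _ _ lebS lebS0 lebS_ge0 lebS_sigma_additive.

Let lebS_sigma_finite : sigma_finite setT lebS.
Proof.
have /sigma_finiteP[F [TF ndF Foo]] := sigma_finiteT (@lebesgue_measure R).
have /sigma_finiteP[G [TG ndG Goo]] := sigma_finiteT mu.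
exists (fun k => @unconsRd d @^-1` (F k `*` G k)).
  rewrite -preimage_bigcup (_ : \bigcup_i _ = setT) ?preimage_setT//.
  apply/seteqP; split=> // -[x y] _.
  have [n _ Fnx] : (\bigcup_i F i) x by rewrite -TF.
  have [k _ Gky] : (\bigcup_i G i) y by rewrite -TG.
  exists (maxn n k) => //; split => /=.
  - by move: x Fnx; exact/subsetPset/ndF/leq_maxl.
  - by move: y Gky; exact/subsetPset/ndG/leq_maxr.
move=> k; have [mF Fk] := Foo k; have [mG Gk] := Goo k; split.
  rewrite -[X in measurable X]setTI; apply: measurable_unconsRd => //.
  exact: measurableX.
rewrite /lebS /pushforward -comp_preimage (_ : _ \o _ = id); last first.
  exact/funext/consRdK.
by rewrite preimage_id product_measure1E// lte_mul_pinfty// ge0_fin_numE.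
Qed.

HB.instance Definition _ :=
  Measure_isSigmaFinite.Build _ _ _ lebS lebS_sigma_finite.

End step.

Fixpoint lebesgue_Rd d : {sigma_finite_measure set (Rd R d) -> \bar R} :=
  match d with
  | 0 => dirac ((0 : 'rV[R]_0) : Rd R 0)
  | d'.+1 => lebS (lebesgue_Rd d')
  end.

Lemma lebesgue_Rd_box d (a b : 'rV[R]_d) : (forall i, a ord0 i <= b ord0 i) ->
  lebesgue_Rd d [set v | forall i,
    a ord0 i <= (v : 'rV[R]_d) ord0 i <= b ord0 i] =
  (\prod_i (b ord0 i - a ord0 i))%:E.
Proof.
elim: d a b => [|d IHd] a b ab /=.
  by rewrite big_ord0 diracE mem_set// => -[].
pose a' : 'rV_d := rsubmx (a : 'rV_(1 + d)).
pose b' : 'rV_d := rsubmx (b : 'rV_(1 + d)).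
have E0 : lshift d (ord0 : 'I_1) = ord0 :> 'I_d.+1 by exact: val_inj.
have ES i : rshift 1 i = lift ord0 i :> 'I_d.+1 by exact: val_inj.
rewrite /lebS /pushforward (_ : _ @^-1` _ =
  `[a ord0 ord0, b ord0 ord0]%classic `*`
  [set v : Rd R d | forall i,
     a' ord0 i <= (v : 'rV[R]_d) ord0 i <= b' ord0 i]); last first.
  have c0 x (v : 'rV_d) : (consRd (x, v) : 'rV_d.+1) ord0 ord0 = x.
    by rewrite -E0; apply: etrans (row_mxEl _ _ _ _) _; rewrite mxE.
  have cS x (v : 'rV_d) i :
      (consRd (x, v) : 'rV_d.+1) ord0 (lift ord0 i) = v ord0 i.
    by rewrite -ES; exact: row_mxEr.
  apply/seteqP; split=> -[x v] /=.
    move=> h; split => [|i]; first by rewrite /= in_itv/=; have := h ord0; rewrite c0.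
    by have := h (lift ord0 i); rewrite cS !mxE !ES.
  rewrite in_itv /= => -[x_ v_] i.
  have [j ->|->] := unliftP ord0 i; last by rewrite c0.
  by rewrite cS; have := v_ j; rewrite !mxE !ES.
have mI : measurable [set v : Rd R d | forall i,
    a' ord0 i <= (v : 'rV[R]_d) ord0 i <= b' ord0 i].
  rewrite (_ : [set _ | _] = \bigcap_(i in [set: 'I_d])
     ((fun v : 'rV[R]_d => v ord0 i) @^-1` `[a' ord0 i, b' ord0 i]%classic)).
    apply: fin_bigcap_measurable => // i _.
    by rewrite -[X in measurable X]setTI; exact: measurable_coord.
  apply/seteqP; split=> v /= h i; first by move=> _; rewrite /= in_itv; exact: h.
  by have := h i Logic.I; rewrite /= in_itv.
rewrite product_measure1E// IHd; last by move=> i; rewrite !mxE.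
rewrite big_ord_recl.
rewrite [X in (X * _)%E](lebesgue_measure_itv `[a ord0 ord0, b ord0 ord0])/= lte_fin.
rewrite (eq_bigr (fun i => b ord0 (lift ord0 i) - a ord0 (lift ord0 i))).
  have [_|] := ltP; first by rewrite -EFinB -EFinM.
  move=> ba; have -> : b ord0 ord0 = a ord0 ord0.
    by apply/eqP; rewrite eq_le ba ab.
  by rewrite subrr mul0r mul0e.
by move=> i _; rewrite !mxE !ES.
Qed.

End Lebesgue.

Section L2.
Context {R : realType} {d : nat} (Om : set 'rV[R]_d).
Local Notation X := 'rV[R]_d.
Local Notation C := R[i].
Local Notation mu := (lebesgue_Rd d).
Implicit Types f g h u v w : X -> C.

(* Elements of L^2(Om) are represented by complex-valued functions on the whole
   space, of which only the restriction to Om matters. *)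
Definition inL2 f : Prop :=
  (((@complex.Re R \o f) \_ Om : Rd R d -> R) \in Lfun mu 2%:E) /\
  (((@complex.Im R \o f) \_ Om : Rd R d -> R) \in Lfun mu 2%:E).

Definition eqL2 f g : Prop := {ae mu, forall x : Rd R d, Om x -> f x = g x}.

Definition ip f g : C :=
  Complex (\int[mu]_(x in (Om : set (Rd R d))) complex.Re (f x * conjc (g x)))
          (\int[mu]_(x in (Om : set (Rd R d))) complex.Im (f x * conjc (g x))).

Definition L2norm f : R := Num.sqrt (complex.Re (ip f f)).

(* Orthogonal projection onto a (finite-dimensional) subspace V of L^2(Om). *)
Definition is_orth_proj (V : set (X -> C)) f p : Prop :=
  V p /\ forall h, V h -> ip (fun x => f x - p x) h = 0.

(* Linear operators in L^2(Om) are represented by their graphs. *)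
Implicit Types G : (X -> C) -> (X -> C) -> Prop.

Definition densely_defined G : Prop :=
  forall f, inL2 f -> forall e : R, 0 < e ->
    exists u w, G u w /\ L2norm (fun x => f x - u x) < e.

Definition adjoint G v h : Prop :=
  [/\ inL2 v, inL2 h & forall u w, G u w -> ip w v = ip u h].

Definition self_adjoint G : Prop :=
  densely_defined G /\ forall v h, G v h <-> adjoint G v h.

(* When G is the graph of -A: v lies in the domain and z v + A v = f. *)
Definition solves G (z : C) f v : Prop := G v (fun x => z * v x - f x).

(* z is in the resolvent set: z I - G is a bijection from the domain of G onto
   L^2(Om), with bounded inverse. *)
Definition resolvent_set G (z : C) : Prop :=
  exists M : R, forall f, inL2 f ->
    exists v, [/\ solves G z f v, L2norm v <= M * L2norm f &
      forall v', solves G z f v' -> eqL2 v' v].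

Definition orthonormal_basis (phi : nat -> X -> C) : Prop :=
  [/\ forall n, inL2 (phi n),
      forall m n, ip (phi m) (phi n) = (m == n)%:R &
      forall f, inL2 f ->
        L2norm (fun x => f x - \sum_(k < n) ip f (phi k) * phi k x)
          @[n --> \oo] --> (0 : R)].

Definition eigensystem G (lam : nat -> R) (phi : nat -> X -> C) : Prop :=
  [/\ 0 < lam 0, nondecreasing_seq lam, lam n @[n --> \oo] --> +oo,
      forall n, G (phi n) (fun x => (lam n)%:C%C * phi n x) &
      orthonormal_basis phi].

(* Span of the eigenfunctions whose eigenvalue is less than c. *)
Definition low_modes (lam : nat -> R) (phi : nat -> X -> C) (c : R)
    : set (X -> C) :=
  [set f | inL2 f /\ exists (m : nat) (al : nat -> C),
     eqL2 f (fun x => \sum_(k < m | lam k < c) al k * phi k x)].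

(* Bochner integral over the line of a function with values in L^2(Om). *)
Record simple := Simple {
  simple_size : nat;
  simple_set : nat -> set (measurableTypeR R);
  simple_val : nat -> X -> C }.

Definition simple_wf (s : simple) : Prop :=
  forall j, (j < simple_size s)%N ->
    [/\ measurable (simple_set s j),
        (lebesgue_measure (simple_set s j) < +oo)%E & inL2 (simple_val s j)].

Definition simple_eval (s : simple) (y : R) (x : X) : C :=
  \sum_(j < simple_size s) (\1_(simple_set s j) y)%:C%C * simple_val s j x.

Definition simple_integral (s : simple) (x : X) : C :=
  \sum_(j < simple_size s)
    (fine (lebesgue_measure (simple_set s j)))%:C%C * simple_val s j x.

Definition is_bochner (F : R -> X -> C) (J : X -> C) : Prop :=
  [/\ forall y, inL2 (F y), inL2 J &
   exists s : nat -> simple,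
     [/\ forall k, simple_wf (s k),
         forall y, L2norm (fun x => simple_eval (s k) y x - F y x)
                     @[k --> \oo] --> (0 : R),
         (\int[lebesgue_measure]_(y in [set: measurableTypeR R])
            (L2norm (fun x => simple_eval (s k) y x - F y x))%:E)%E
            @[k --> \oo] --> (0%:E : \bar R) &
         L2norm (fun x => simple_integral (s k) x - J x)
            @[k --> \oo] --> (0 : R)]].

(* J is the integral of F z dz along the curve y |-> z y. *)
Definition is_contour_integral (z : R -> C) (F : C -> X -> C) (J : X -> C) :=
  is_bochner (fun y x =>
    Complex (derive1 (@complex.Re R \o z) y) (derive1 (@complex.Im R \o z) y)
      * F (z y) x) J.

End L2.

Section Elliptic.
Context {R : realType} {d : nat} (Om : set 'rV[R]_d).
Local Notation X := 'rV[R]_d.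
Local Notation C := R[i].
Local Notation mu := (lebesgue_Rd d).

Definition domain : Prop := [/\ open Om, connected Om & Om !=set0].

Definition partial (i : 'I_d) (f : X -> R) (x : X) : R :=
  'D_(delta_mx ord0 i) f x.

Definition smooth (f : X -> R) : Prop :=
  forall s : seq 'I_d, continuous (foldr partial f s) /\
    forall i x, derivable (foldr partial f s) x (delta_mx ord0 i).

Definition test_function (psi : X -> C) : Prop :=
  [/\ smooth (@complex.Re R \o psi), smooth (@complex.Im R \o psi),
      compact (closure [set x | psi x != 0]) &
      closure [set x | psi x != 0] `<=` Om].

Definition cpartial (i : 'I_d) (psi : X -> C) (x : X) : C :=
  Complex (partial i (@complex.Re R \o psi) x) (partial i (@complex.Im R \o psi) x).

(* u is in H^1_0(Om), the closure of the test functions in the H^1 norm, and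
   Du is its weak gradient. *)
Definition inH10 (u : X -> C) (Du : 'I_d -> X -> C) : Prop :=
  [/\ inL2 Om u, forall i, inL2 Om (Du i) &
   exists psi : nat -> X -> C,
     [/\ forall k, test_function (psi k),
         L2norm Om (fun x => psi k x - u x) @[k --> \oo] --> (0 : R) &
         forall i, L2norm Om (fun x => cpartial i (psi k) x - Du i x)
           @[k --> \oo] --> (0 : R)]].

(* Coefficients of the operator
     - sum_i d_i (sum_j a_ij d_j u + b_i u) + sum_i c_i d_i u + q u. *)
Record coefficients := Coefficients {
  coef_a : 'I_d -> 'I_d -> X -> R;
  coef_b : 'I_d -> X -> R;
  coef_c : 'I_d -> X -> R;
  coef_q : X -> R }.

Definition Linfty (f : X -> R) : Prop :=
  measurable_fun (Om : set (Rd R d)) (f : Rd R d -> R) /\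
  exists M : R, {ae mu, forall x : Rd R d, Om x -> `|f x| <= M}.

Definition uniformly_elliptic (L : coefficients) : Prop :=
  [/\ forall i j, Linfty (coef_a L i j), forall i, Linfty (coef_b L i),
      forall i, Linfty (coef_c L i), Linfty (coef_q L) &
   exists2 th : R, 0 < th &
     {ae mu, forall x : Rd R d, Om x -> forall xi : 'I_d -> R,
        th * \sum_i xi i ^+ 2 <=
        \sum_i \sum_j coef_a L i j x * xi i * xi j}].

(* Graph of the operator with homogeneous Dirichlet boundary condition: u is
   in H^1_0(Om) and is mapped, in the weak sense, to f in L^2(Om). *)
Definition dirichlet_op (L : coefficients) (u f : X -> C) : Prop :=
  inL2 Om f /\
  exists Du, inH10 u Du /\
    forall psi, test_function psi ->
      \sum_i ip Om (fun x => \sum_j (coef_a L i j x)%:C%C * Du j x +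
                             (coef_b L i x)%:C%C * u x) (cpartial i psi) +
      ip Om (fun x => \sum_i (coef_c L i x)%:C%C * Du i x +
                      (coef_q L x)%:C%C * u x) psi =
      ip Om f psi.

End Elliptic.

Section Regularization.
Context {R : realType} {d : nat}.
Local Notation X := 'rV[R]_d.
Local Notation C := R[i].

Definition cexp (z : C) : C :=
  (expR (complex.Re z))%:C%C * Complex (cos (complex.Im z)) (sin (complex.Im z)).

Definition hyperbola (gam nu sig : R) (y : R) : C :=
  Complex (gam - Num.sqrt (nu ^+ 2 + y ^+ 2)) (sig * y).

(* u is u^{Gamma,u0} on [0, T]; Gamma is the curve y |-> z y, the operator -A
   has graph G, and c is the bound (log Lambda) / T defining Pi_Gamma. *)
Definition regularized_solution (Om : set X) (G : (X -> C) -> (X -> C) -> Prop)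
    (lam : nat -> R) (phi : nat -> X -> C) (z : R -> C) (T c : R)
    (u0 : X -> C) (u : R -> X -> C) : Prop :=
  (exists v : C -> X -> C,
     (forall y, solves G (z y) u0 (v (z y))) /\
     forall t, 0 < t <= T ->
       exists2 J, is_contour_integral Om z
                    (fun w x => cexp (w * t%:C%C) * v w x) J &
         forall x, u t x = (2%:R * pi%:C%C * 'i%C)^-1 * J x) /\
  is_orth_proj Om (low_modes Om lam phi c) u0 (u 0).

End Regularization.

(* Main.v *)
Require Import Defs.
From HB Require Import structures.
From mathcomp Require Import all_boot all_order all_algebra.
From mathcomp Require Import all_classical all_reals all_analysis measurable_realfun.
From mathcomp Require Import complex ring lra.

(* Pairing the resolvent equation with the eigenfunction [phi k] shows that the
   [k]-th coefficient of [v z] is [a / (z - lam k)], where [a] is that of the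
   initial datum.  By the residue theorem the coefficient of the contour
   integral is then [e^(t lam k) a] if [lam k] lies to the left of the vertex of
   the hyperbola, that is [lam k < log Lambda / T], and [0] otherwise.  As
   [e^(t lam k) <= Lambda^(t/T)] for the surviving modes, Parseval's identity
   bounds the norm of the difference of two solutions by [Lambda^(t/T)] times
   that of the difference of the data, which is at most [2 delta].

   The residue theorem is obtained by differentiation in [t].  With
   [w = z - lam], the integral [I t] of [e^(t w) w' / w] along the hyperbola has
   as derivative the integral of [e^(t w) w'], which is zero, so [I] is constant
   on [t > 0].  If the hyperbola lies to the left of [lam], let [t] tend to
   infinity to get [I = 0].  Otherwise, subtract the analogous integral, which
   vanishes, for a translate of the hyperbola to the left of [0], and let [t]
   tend to [0]: [I] is the integral of the difference of the two logarithmic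
   derivatives, that is the variation [2 pi i] of an explicit logarithm. *)

Set Implicit Arguments.
Unset Strict Implicit.
Unset Printing Implicit Defensive.
Import Order.TTheory GRing.Theory Num.Theory.
Import numFieldNormedType.Exports.

Local Open Scope classical_set_scope.
Local Open Scope ring_scope.

(** * Modulus, exponential and continuity for complex-valued functions *)

Section ComplexValued.
Context {R : realType}.
Local Notation C := R[i].
Local Notation Re := (@complex.Re R).
Local Notation Im := (@complex.Im R).
Local Notation leb := (@lebesgue_measure R).
Implicit Types (f g : R -> C) (z w : C) (x y t : R).

(** Real-valued, unlike the norm of [R[i]], so that it can be compared with real majorants. *)
Definition modulus z : R := Num.sqrt (Re z ^+ 2 + Im z ^+ 2).

Lemma modulusE z : modulus z = Normc.normc z.
Proof. by case: z. Qed.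

Lemma modulus_ge0 z : 0 <= modulus z. Proof. exact: sqrtr_ge0. Qed.

Lemma modulusM z w : modulus (z * w) = modulus z * modulus w.
Proof. by rewrite !modulusE Normc.normcM. Qed.

Lemma modulusV z : modulus z^-1 = (modulus z)^-1.
Proof. by rewrite !modulusE Normc.normcV. Qed.

Lemma modulus_gt0 z : (0 < modulus z) = (z != 0).
Proof.
rewrite lt0r modulus_ge0 andbT; congr (~~ _); apply/eqP/eqP => [|->].
  by rewrite modulusE => /Normc.eq0_normc.
by rewrite modulusE Normc.normc0.
Qed.

Lemma sqr_modulus z : modulus z ^+ 2 = Re z ^+ 2 + Im z ^+ 2.
Proof. by rewrite sqr_sqrtr// addr_ge0// sqr_ge0. Qed.

Lemma abs_Re_le z : `|Re z| <= modulus z.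
Proof. by rewrite -sqrtr_sqr ler_wsqrtr// lerDl sqr_ge0. Qed.

Lemma abs_Im_le z : `|Im z| <= modulus z.
Proof. by rewrite -sqrtr_sqr ler_wsqrtr// lerDr sqr_ge0. Qed.

Lemma modulus_cexp z : modulus (cexp z) = expR (Re z).
Proof.
case: z => a b; rewrite /cexp modulusM /modulus /=.
rewrite expr0n addr0 sqrtr_sqr ger0_norm ?expR_ge0//.
by rewrite cos2Dsin2 sqrtr1 mulr1.
Qed.

Lemma cexpD z w : cexp (z + w) = cexp z * cexp w.
Proof.
case: z => a b; case: w => c e; rewrite /cexp /= expRD cosD sinD.
by rewrite rmorphM /=; apply/eqP; rewrite eq_complex /=; apply/andP; split; apply/eqP; ring.
Qed.

Lemma cexpE z : cexp z = Complex (expR (Re z) * cos (Im z)) (expR (Re z) * sin (Im z)).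
Proof. by rewrite /cexp; apply/eqP; rewrite eq_complex /= !mul0r subr0 addr0 !eqxx. Qed.

(** Componentwise, because integrals and derivatives are taken separately on real and imaginary
    parts. *)
Definition ccontinuous f := continuous (Re \o f) /\ continuous (Im \o f).

Lemma ccontinuousD f g : ccontinuous f -> ccontinuous g ->
  ccontinuous (fun y => f y + g y).
Proof.
move=> [f1 f2] [g1 g2]; split => y.
  rewrite (_ : _ \o _ = fun y => Re (f y) + Re (g y)).
    by apply: cvgD; [exact: f1|exact: g1].
  by apply/funext => u /=; case: (f u) (g u) => ? ? [].
rewrite (_ : _ \o _ = fun y => Im (f y) + Im (g y)).
  by apply: cvgD; [exact: f2|exact: g2].
by apply/funext => u /=; case: (f u) (g u) => ? ? [].
Qed.

Lemma Re_mul z w : Re (z * w) = Re z * Re w - Im z * Im w.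
Proof. by case: z w => ? ? []. Qed.

Lemma Im_mul z w : Im (z * w) = Re z * Im w + Im z * Re w.
Proof. by case: z w => ? ? []. Qed.

Lemma Re_add z w : Re (z + w) = Re z + Re w. Proof. by case: z w => ? ? []. Qed.
Lemma Im_add z w : Im (z + w) = Im z + Im w. Proof. by case: z w => ? ? []. Qed.
Lemma Re_opp z : Re (- z) = - Re z. Proof. by case: z. Qed.
Lemma Im_opp z : Im (- z) = - Im z. Proof. by case: z. Qed.
Lemma Re_inv z : Re z^-1 = Re z / (Re z ^+ 2 + Im z ^+ 2). Proof. by case: z. Qed.
Lemma Im_inv z : Im z^-1 = - Im z / (Re z ^+ 2 + Im z ^+ 2).
Proof. by rewrite mulNr; case: z. Qed.

Lemma ccontinuousM f g : ccontinuous f -> ccontinuous g ->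
  ccontinuous (fun y => f y * g y).
Proof.
move=> [f1 f2] [g1 g2]; split => y.
  rewrite (_ : _ \o _ = fun y => Re (f y) * Re (g y) - Im (f y) * Im (g y)).
    by apply: cvgB; apply: cvgM; [exact: f1|exact: g1|exact: f2|exact: g2].
  by apply/funext => u /=; rewrite Re_mul.
rewrite (_ : _ \o _ = fun y => Re (f y) * Im (g y) + Im (f y) * Re (g y)).
  by apply: cvgD; apply: cvgM; [exact: f1|exact: g2|exact: f2|exact: g1].
by apply/funext => u /=; rewrite Im_mul.
Qed.

Lemma ccontinuousV f : ccontinuous f -> (forall y, f y != 0) ->
  ccontinuous (fun y => (f y)^-1).
Proof.
move=> [f1 f2] f0.
have n0 y : Re (f y) ^+ 2 + Im (f y) ^+ 2 != 0.
  by rewrite -sqr_modulus expf_neq0// gt_eqF// modulus_gt0.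
have c y : (fun y => (Re (f y) ^+ 2 + Im (f y) ^+ 2)^-1) @ y -->
    (Re (f y) ^+ 2 + Im (f y) ^+ 2)^-1.
  apply: cvgV => //.
  apply: cvgD.
    exact: (cvg_comp _ (fun u : R => u ^+ 2) (f1 y) (@exprn_continuous _ 2 _)).
  exact: (cvg_comp _ (fun u : R => u ^+ 2) (f2 y) (@exprn_continuous _ 2 _)).
split => y.
  rewrite (_ : _ \o _ = fun y => Re (f y) * (Re (f y) ^+ 2 + Im (f y) ^+ 2)^-1).
    by apply: cvgM; [exact: f1|exact: c].
  by apply/funext => u /=; rewrite Re_inv.
rewrite (_ : _ \o _ = fun y => - Im (f y) * (Re (f y) ^+ 2 + Im (f y) ^+ 2)^-1).
  by apply: cvgM; [apply: cvgN; exact: f2|exact: c].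
by apply/funext => u /=; rewrite Im_inv.
Qed.

Lemma ccontinuous_cexp f : ccontinuous f -> ccontinuous (fun y => cexp (f y)).
Proof.
move=> [f1 f2]; split => y.
  rewrite (_ : _ \o _ = fun y => expR (Re (f y)) * cos (Im (f y))).
    apply: cvgM; apply: (continuous_comp (f := _ \o f)).
    - exact: f1.
    - exact: continuous_expR.
    - exact: f2.
    - exact: continuous_cos.
  by apply/funext => u; rewrite /comp cexpE.
rewrite (_ : _ \o _ = fun y => expR (Re (f y)) * sin (Im (f y))).
  apply: cvgM; apply: (continuous_comp (f := _ \o f)).
  - exact: f1.
  - exact: continuous_expR.
  - exact: f2.
  - exact: continuous_sin.
by apply/funext => u; rewrite /comp cexpE.
Qed.

Lemma ccontinuous_cst z : ccontinuous (fun=> z).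
Proof. by split => y; exact: cvg_cst. Qed.

End ComplexValued.

(** * Integrals over the real line with a Lorentzian majorant *)

Section RealLine.
Context {R : realType}.
Local Notation leb := (@lebesgue_measure R).
Implicit Types f F : R -> R.

Lemma ler_of_sqr (u v : R) : 0 <= v -> u ^+ 2 <= v ^+ 2 -> u <= v.
Proof. by move=> v0 uv; nra. Qed.

(** The Cauchy density up to a constant; it serves as integrable majorant for the integrands along
    the hyperbola. *)
Definition lorentz (K y : R) : R := K / (1 + y ^+ 2).

Lemma lorentz_gt0 y : 0 < 1 + y ^+ 2 :> R.
Proof. by rewrite ltr_pwDl// sqr_ge0. Qed.

Lemma integrable_lorentz K : leb.-integrable [set: R] (EFin \o lorentz K).
Proof.
have h1 : leb.-integrable [set: R] (EFin \o (fun y => (1 + y ^+ 2)^-1)).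
  have c : continuous (fun y : R => (1 + y ^+ 2)^-1) by exact: continuous_oneDsqrV.
  apply/integrableP; split.
    by apply/measurable_EFinP; exact: continuous_measurable_fun.
  under eq_integral => y _ do rewrite /= ger0_norm ?invr_ge0 ?(ltW (lorentz_gt0 _))//.
  (* The integrand is even, so its integral is twice that over the half line, a known arctangent
     integral. *)
  rewrite ge0_symfun_integralT//; last 2 first.
  - by move=> y; rewrite invr_ge0 ltW// lorentz_gt0.
  - by move=> y /=; rewrite sqrrN.
  rewrite -set_itvcy.
  by rewrite [X in (_ * X)%E]integral0y_oneDsqr -EFinM ltry.
rewrite (_ : _ \o _ = fun y => (K%:E * (((1 + y ^+ 2)^-1)%R)%:E)%E)//.
exact: integrableZl.
Qed.

Lemma dominated_integrable f K : continuous f ->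
  (forall y, `|f y| <= lorentz K y) -> leb.-integrable [set: R] (EFin \o f).
Proof.
move=> cf fK; apply: le_integrable (integrable_lorentz K) => //.
  by apply/measurable_EFinP; exact: continuous_measurable_fun.
by move=> y _ /=; rewrite lee_fin (le_trans (fK y))// ler_norm.
Qed.

Lemma abs_Rintegral_le f K : continuous f -> (forall y, `|f y| <= lorentz K y) ->
  `|\int[leb]_y f y| <= \int[leb]_y lorentz K y.
Proof.
move=> cf fK; have If := dominated_integrable cf fK.
rewrite (le_trans (le_normr_Rintegral _ If))//; apply: le_Rintegral => //.
  exact: (integrable_norm If).
exact: integrable_lorentz.
Qed.

Lemma dominated_cvg_Rintegral (f_ : nat -> R -> R) f K : (forall n, continuous (f_ n)) ->
  continuous f -> (forall n y, `|f_ n y| <= lorentz K y) ->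
  (forall y, f_ n y @[n --> \oo] --> f y) ->
  \int[leb]_y f_ n y @[n --> \oo] --> \int[leb]_y f y.
Proof.
move=> cf_ cf fK f_f.
have m (g : R -> R) : continuous g -> measurable_fun [set: R] (EFin \o g).
  by move=> cg; apply/measurable_EFinP; exact: continuous_measurable_fun.
have [|||If _ h] := @dominated_convergence _ _ _ leb [set: R] measurableT
    (fun n => EFin \o f_ n) (EFin \o f) (EFin \o lorentz K) (fun n => m _ (cf_ n)) (m _ cf).
- by apply: aeW => y _; apply: cvg_EFin (f_f y); exact: nearW.
- exact: integrable_lorentz.
- by apply: aeW => y n _; rewrite lee_fin.
by move: h; rewrite -(fineK (integrable_fin_num measurableT If)) => /fine_cvg.
Qed.

(** The fundamental theorem applies to the truncations of [f] to [[-(n+1), n+1]], which converge in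
    the mean by domination by [|f|]. As [f] is assumed integrable, the limit of the symmetric
    increments of [F] suffices. *)
Lemma Rintegral_FTC f F l : continuous f -> leb.-integrable [set: R] (EFin \o f) ->
  (forall y, is_derive y (1 : R) F (f y)) ->
  F n.+1%:R - F (- n.+1%:R) @[n --> \oo] --> l -> \int[leb]_y f y = l.
Proof.
move=> cf If dF Fl.
have m : measurable_fun [set: R] f by exact: continuous_measurable_fun.
pose A n : set R := `[- n.+1%:R, n.+1%:R]%classic.
have mA n : measurable (A n) by exact: measurable_itv.
have [|||||_ _ h] := @dominated_convergence _ _ _ leb [set: R] measurableT
    (fun n => (EFin \o f) \_ (A n)) (EFin \o f) (abse \o (EFin \o f)).
- by move=> n; apply/(measurable_restrictT _ (mA n)); exact/measurable_EFinP/measurable_funTS.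
- exact/measurable_EFinP.
- apply: aeW => y _; apply: cvg_near_cst.
  near=> n; rewrite patchE ifT// inE /A /= in_itv/= -ler_norml.
  near: n; exists (Num.truncn `|y|) => // n /= yn.
  apply: (le_trans (ltW (truncnS_gt _))); by rewrite ler_nat ltnS.
- exact: integrable_abse.
- apply: aeW => y n _; rewrite patchE; case: ifPn => // _; rewrite abse0; exact: abse_ge0.
have E : (fun n => \int[leb]_x ((EFin \o f) \_ (A n)) x)%E =
    (fun n => (F n.+1%:R - F (- n.+1%:R))%:E).
  apply/funext => n; rewrite -integral_mkcond /A (continuous_FTC2 (F := F))//.
  - by rewrite gtrN// ltr0n.
  - exact: continuous_subspaceT.
  - have cF : continuous F.
      by move=> y; apply/differentiable_continuous/derivable1_diffP; exact: ex_derive.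
    split=> [y _||]; first exact: ex_derive.
      by apply: cvg_at_right_filter; exact: cF.
    by apply: cvg_at_left_filter; exact: cF.
  - by move=> y _; rewrite derive1E; exact: derive_val.
have {}h : (F n.+1%:R - F (- n.+1%:R))%:E @[n --> \oo] --> (\int[leb]_y (f y)%:E)%E.
  by move: h; rewrite E.
have h' : F n.+1%:R - F (- n.+1%:R) @[n --> \oo] --> \int[leb]_y f y.
  by move: h; rewrite -(fineK (integrable_fin_num measurableT If)) => /fine_cvg.
exact: (cvg_unique _ h' Fl).
Unshelve. all: by end_near. Qed.

End RealLine.

(** * Differentiation rules, up to the two parts of a logarithm *)

Section Derivatives.
Context {R : realType}.
Implicit Types (X Y : R -> R) (y a b : R).

Lemma is_derive_continuous (f g : R -> R) : (forall y, is_derive y 1 f (g y)) -> continuous f.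
Proof.
by move=> df y; apply/differentiable_continuous/derivable1_diffP; exact: ex_derive.
Qed.

Lemma is_derive_fD X Y y a b : is_derive y 1 X a -> is_derive y 1 Y b ->
  is_derive y 1 (fun y => X y + Y y) (a + b).
Proof. exact: is_deriveD. Qed.

Lemma is_derive_fB X Y y a b : is_derive y 1 X a -> is_derive y 1 Y b ->
  is_derive y 1 (fun y => X y - Y y) (a - b).
Proof. exact: is_deriveB. Qed.

Lemma is_derive_fM X Y y a b : is_derive y 1 X a -> is_derive y 1 Y b ->
  is_derive y 1 (fun y => X y * Y y) (X y * b + Y y * a).
Proof. exact: is_deriveM. Qed.

Lemma is_derive_fZ X y a b : is_derive y 1 X a ->
  is_derive y 1 (fun y => b * X y) (b * a).
Proof. exact: is_deriveZ. Qed.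

Lemma is_derive_fX2 X y a : is_derive y 1 X a ->
  is_derive y 1 (fun y => X y ^+ 2) (2 * X y * a).
Proof.
move=> Xa; rewrite (_ : (fun _ => _) = fun y => X y * X y).
  by apply: is_derive_eq (is_derive_fM Xa Xa) _; ring.
by apply/funext => u; rewrite expr2.
Qed.

Lemma is_derive_fV X y a : X y != 0 -> is_derive y 1 X a ->
  is_derive y 1 (fun y => (X y)^-1) (- a / X y ^+ 2).
Proof.
move=> X0 Xa; apply: is_derive_eq (is_deriveV X0 Xa) _.
by rewrite /GRing.scale /= mulrC mulNr mulrN.
Qed.

(** The function is the logarithm of the modulus of [X + i Y], so its derivative is the real part of
    [(a + i b) / (X + i Y)]. *)
Lemma is_derive_ln_modulus X Y y a b : is_derive y 1 X a -> is_derive y 1 Y b ->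
  0 < X y ^+ 2 + Y y ^+ 2 ->
  is_derive y 1 (fun y => ln (X y ^+ 2 + Y y ^+ 2) / 2)
    ((X y * a + Y y * b) / (X y ^+ 2 + Y y ^+ 2)).
Proof.
move=> Xa Yb XY0.
have d1 := is_derive_fD (is_derive_fX2 Xa) (is_derive_fX2 Yb).
have d2 := is_derive1_comp (is_derive1_ln XY0 :
  is_derive ((fun y => X y ^+ 2 + Y y ^+ 2) y) 1 (@ln R) _) d1.
rewrite (_ : (fun _ => _) = fun y => 2^-1 * (@ln R \o (fun y => X y ^+ 2 + Y y ^+ 2)) y).
  by apply: is_derive_eq (is_derive_fZ _ d2) _; field; rewrite gt_eqF.
by apply/funext => u; rewrite mulrC.
Qed.

(* [2 atan (Y / (rho + X))] is the principal argument of [X + i Y]. *)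
Lemma is_derive_arg X Y y a b : is_derive y 1 X a -> is_derive y 1 Y b ->
  0 < Num.sqrt (X y ^+ 2 + Y y ^+ 2) + X y ->
  is_derive y 1 (fun y => 2 * atan (Y y / (Num.sqrt (X y ^+ 2 + Y y ^+ 2) + X y)))
    ((X y * b - Y y * a) / (X y ^+ 2 + Y y ^+ 2)).
Proof.
move=> Xa Yb; set h := X y ^+ 2 + Y y ^+ 2 => rX.
have h0 : 0 < h.
  rewrite lt0r addr_ge0 ?sqr_ge0// andbT; apply/negP => /eqP h0.
  move: rX; rewrite h0 sqrtr0 add0r => X0.
  by move: h0; rewrite /h => /eqP; rewrite paddr_eq0 ?sqr_ge0// expf_eq0/= gt_eqF.
have d1 := is_derive_fD (is_derive_fX2 Xa) (is_derive_fX2 Yb).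
have d2 := is_derive_fD (is_derive1_comp
  (is_derive1_sqrt h0 : is_derive ((fun y => X y ^+ 2 + Y y ^+ 2) y) 1 _ _) d1) Xa.
pose S u := Num.sqrt (X u ^+ 2 + Y u ^+ 2) + X u.
have rX' : S y != 0 by rewrite gt_eqF.
have d3 := is_derive_fM Yb (is_derive_fV (X := S) rX' d2).
have d4 := is_derive_fZ 2 (is_derive1_comp (is_derive1_atan _) d3).
apply: is_derive_eq d4 _; rewrite /S -/h.
set r := Num.sqrt h; have r2 : r ^+ 2 = h by rewrite sqr_sqrtr// ltW.
have r0 : 0 < r by rewrite sqrtr_gt0.
rewrite -/r in rX *.
have Y2 : Y y ^+ 2 = r ^+ 2 - X y ^+ 2 by rewrite r2 /h; ring.
(* Half-angle formula: the squared secant of half the argument is [2 / (1 + cos)], with cosine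
   [X / r]. *)
rewrite -r2; have -> : 1 + (Y y / (r + X y)) ^+ 2 = 2 * r / (r + X y).
  by rewrite expr_div_n Y2; field; rewrite gt_eqF.
move: (X y) (Y y) rX Y2 => x z rX Y2.
transitivity ((b * r * (r + x) - z * a * (r + x) - z ^+ 2 * b) / (r ^+ 2 * (r + x))).
  by field; rewrite !gt_eqF.
by rewrite Y2; field; rewrite !gt_eqF.
Qed.

End Derivatives.

(** * The hyperbola and the decay of the exponential along it *)

Section Hyperbola.
Context {R : realType}.
Local Notation C := R[i].
Local Notation Re := (@complex.Re R).
Local Notation Im := (@complex.Im R).
Local Notation leb := (@lebesgue_measure R).
Variables (nu sig : R).
Hypotheses (nu0 : 0 < nu) (sig0 : 0 < sig).
Implicit Types (a y t : R).

Local Notation r y := (Num.sqrt (nu ^+ 2 + y ^+ 2)).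
Local Notation w a := (hyperbola a nu sig).

(** The velocity of the curve. It does not depend on [a], as the curves [w a] are horizontal
    translates of one another. *)
Definition dhyperbola y : C := Complex (- (y / r y)) sig.

Lemma hyp_arg_gt0 y : 0 < nu ^+ 2 + y ^+ 2.
Proof. by rewrite ltr_pwDl ?sqr_ge0// exprn_gt0. Qed.

Lemma radius_gt0 y : 0 < r y.
Proof. by rewrite sqrtr_gt0 hyp_arg_gt0. Qed.

Lemma sqr_radius y : r y ^+ 2 = nu ^+ 2 + y ^+ 2.
Proof. by rewrite sqr_sqrtr// ltW// hyp_arg_gt0. Qed.

Lemma radius_ge y : nu <= r y.
Proof.
by apply: ler_of_sqr; rewrite ?sqr_radius ?lerDl ?sqr_ge0// ltW// radius_gt0.
Qed.

Lemma is_derive_radius y : is_derive y 1 (fun y => r y) (y / r y).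
Proof.
have d1 : is_derive y 1 (fun y => nu ^+ 2 + y ^+ 2) (0 + 2 * y * 1).
  exact: is_derive_fD (is_derive_cst (nu ^+ 2) y 1) (is_derive_fX2 (is_derive_id y 1)).
have d2 := is_derive1_comp (is_derive1_sqrt (hyp_arg_gt0 y) :
  is_derive ((fun y => nu ^+ 2 + y ^+ 2) y) 1 _ _) d1.
by apply: is_derive_eq d2 _; field; rewrite gt_eqF ?radius_gt0.
Qed.

Lemma is_derive_Re_hyperbola a y : is_derive y 1 (Re \o w a) (Re (dhyperbola y)).
Proof.
apply: is_derive_eq (is_derive_fB (is_derive_cst a y 1) (is_derive_radius y)) _.
by rewrite sub0r.
Qed.

Lemma is_derive_Im_hyperbola a y : is_derive y 1 (Im \o w a) sig.
Proof. by apply: is_derive_eq (is_derive_fZ sig (is_derive_id y 1)) _; rewrite mulr1. Qed.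

Lemma derive1_hyperbola a y :
  Complex (derive1 (Re \o w a) y) (derive1 (Im \o w a) y) = dhyperbola y.
Proof.
rewrite !derive1E; congr Complex; apply: derive_val.
  exact: is_derive_Re_hyperbola.
exact: is_derive_Im_hyperbola.
Qed.

Lemma ccontinuous_hyperbola a : ccontinuous (w a).
Proof.
split.
  exact: (is_derive_continuous (is_derive_Re_hyperbola a)).
exact: (is_derive_continuous (is_derive_Im_hyperbola a)).
Qed.

Lemma ccontinuous_dhyperbola : ccontinuous dhyperbola.
Proof.
split => y; last exact: cvg_cst.
apply: cvgN; apply: cvgM; first exact: cvg_id.
apply: cvgV; first by rewrite gt_eqF ?radius_gt0.
exact: (is_derive_continuous is_derive_radius).
Qed.

Lemma modulus_dhyperbola y : modulus (dhyperbola y) <= 1 + sig.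
Proof.
apply: ler_of_sqr; first by rewrite addr_ge0// ltW.
rewrite sqr_modulus /= sqrrN expr_div_n sqr_radius.
rewrite (@le_trans _ _ (1 + sig ^+ 2))//; last first.
  by rewrite sqrrD expr1n mul1r lerD2r lerDl mulrn_wge0// ltW.
by rewrite lerD2r ler_pdivrMr ?hyp_arg_gt0// mul1r lerDr sqr_ge0.
Qed.

(** The curve crosses the real axis only at its vertex [a - nu], so it avoids 0 when [a != nu], and
    its modulus grows like the radius. Substituting [y^2 = r^2 - nu^2] makes the squared modulus a
    sum of two nonnegative terms in [r] alone, one of which is bounded below in each case. *)
Lemma modulus_hyperbola_ge a : a != nu ->
  exists2 m, 0 < m & forall y, m * r y <= modulus (w a y).
Proof.
move=> anu.
suff [m m0 hm] : exists2 m, 0 < m & forall y,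
    m * r y ^+ 2 <= (a - r y) ^+ 2 + sig ^+ 2 * (r y ^+ 2 - nu ^+ 2).
  exists (Num.sqrt m) => [|y]; first by rewrite sqrtr_gt0.
  apply: ler_of_sqr; first exact: modulus_ge0.
  rewrite exprMn sqr_sqrtr ?(ltW m0)// (le_trans (hm y))// sqr_modulus /=.
  by rewrite exprMn sqr_radius [nu ^+ 2 + _]addrC addrK.
have [alt|age] := ltrP a nu.
  have [a0|a0] := lerP a 0.
    exists 1 => // y; rewrite mul1r.
    have := radius_gt0 y; have := radius_ge y; set s := r y => h1 h2.
    have h5 : 0 <= sig ^+ 2 * (s ^+ 2 - nu ^+ 2).
      by rewrite mulr_ge0 ?sqr_ge0// subr_sqr mulr_ge0 ?subr_ge0// addr_ge0// ltW.
    by rewrite ler_wpDr//; nra.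
  (* Here [0 < a < nu <= r], so [r - a >= (1 - a / nu) r]: the real part alone suffices. *)
  exists ((1 - a / nu) ^+ 2) => [|y].
    by rewrite exprn_gt0// subr_gt0 ltr_pdivrMr// mul1r.
  have := radius_gt0 y; have := radius_ge y; set s := r y => h1 h2.
  have h5 : 0 <= sig ^+ 2 * (s ^+ 2 - nu ^+ 2).
    by rewrite mulr_ge0 ?sqr_ge0// subr_sqr mulr_ge0 ?subr_ge0// addr_ge0// ltW.
  rewrite ler_wpDr//.
  have h3 : a <= a / nu * s by rewrite mulrAC ler_pdivlMr// ler_pM2l.
  have h4 : a / nu * s <= s by rewrite ler_piMl ?(ltW h2)// ler_pdivrMr// mul1r ltW.
  by rewrite -exprMn mulrBl mul1r; nra.
have {age anu}a_nu : nu < a by rewrite lt_neqAle eq_sym anu.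
have an0 : 0 < a + nu by rewrite addr_gt0// (lt_trans nu0).
(* The vertex is now to the right of 0 and the real part vanishes at [r = a]. The midpoint [q] of
   [nu] and [a] separates the region [r <= q], where [a - r >= k r], from [r > q], where the
   imaginary part gives [r^2 - nu^2 >= (1 - (nu / q)^2) r^2]. *)
pose k := (a - nu) / (a + nu).
have k0 : 0 < k by rewrite divr_gt0// subr_gt0.
pose q := (a + nu) / 2.
have q0 : 0 < q by rewrite divr_gt0.
have nuq : nu < q by rewrite /q; lra.
pose l := sig ^+ 2 * (1 - (nu / q) ^+ 2).
have l0 : 0 < l.
  rewrite mulr_gt0 ?exprn_gt0// subr_gt0 expr_lt1// ?divr_ge0 ?ltW//.
  by rewrite ltr_pdivrMr// mul1r.
exists (Num.min (k ^+ 2) l) => [|y]; first by rewrite lt_min exprn_gt0.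
have := radius_gt0 y; have := radius_ge y; set s := r y => h1 h2.
have h5 : 0 <= sig ^+ 2 * (s ^+ 2 - nu ^+ 2).
  by rewrite mulr_ge0 ?sqr_ge0// subr_sqr mulr_ge0 ?subr_ge0// addr_ge0// ltW.
have [sq|qs] := lerP s q.
  rewrite (@le_trans _ _ (k ^+ 2 * s ^+ 2))//.
    by rewrite ler_wpM2r ?sqr_ge0// ge_min lexx.
  rewrite ler_wpDr//.
  have h3 : k * s <= a - s by rewrite /k mulrAC ler_pdivrMr//; move: sq; rewrite /q; nra.
  have h4 : 0 <= k * s by rewrite mulr_ge0// ltW.
  by rewrite -exprMn lerXn2r// nnegrE (le_trans h4).
rewrite (@le_trans _ _ (l * s ^+ 2))//.
  by rewrite ler_wpM2r ?sqr_ge0// ge_min lexx orbT.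
rewrite ler_wpDl ?sqr_ge0// /l -mulrA ler_wpM2l ?sqr_ge0// mulrBl mul1r lerB//.
have h3 : nu <= nu / q * s by rewrite mulrAC ler_pdivlMr// ler_pM2l// ltW.
by rewrite -exprMn lerXn2r// nnegrE ltW// (lt_le_trans nu0).
Qed.

Lemma hyperbola_neq0 a : a != nu -> forall y, w a y != 0.
Proof.
move=> /modulus_hyperbola_ge[m m0 hm] y; rewrite -modulus_gt0.
by rewrite (lt_le_trans _ (hm y))// mulr_gt0// radius_gt0.
Qed.

(** The constant comes from expanding [(1 + nu^-2) (nu^2 + y^2)], which contains [1 + y^2]. *)
Lemma inv_radius2_le : exists2 c, 0 < c & forall y, (r y ^+ 2)^-1 <= lorentz c y.
Proof.
exists (1 + nu ^- 2) => [|y]; first by rewrite ltr_pwDl// invr_ge0 sqr_ge0.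
rewrite ler_pdivlMr ?lorentz_gt0// mulrC ler_pdivrMr ?exprn_gt0 ?radius_gt0//.
rewrite sqr_radius mulrDl !mulrDr mul1r mulVf ?expf_neq0 ?gt_eqF//.
have : 0 <= nu ^- 2 * y ^+ 2 by rewrite mulr_ge0 ?invr_ge0 ?sqr_ge0.
have := sqr_ge0 nu; lra.
Qed.

(** With [a = gam - lam k] this is [e^(t z)] on the contour, stripped of the factor
    [e^(t lam k)]. *)
Definition kern a t y : C := cexp (w a y * t%:C%C).

Lemma modulus_kern a t y : modulus (kern a t y) = expR ((a - r y) * t).
Proof. by rewrite modulus_cexp Re_mul /= mulr0 subr0. Qed.

Lemma ccontinuous_kern a t : ccontinuous (kern a t).
Proof.
apply: ccontinuous_cexp; apply: ccontinuousM; first exact: ccontinuous_hyperbola.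
exact: ccontinuous_cst.
Qed.

(** Uniformity over [[t0, t1]] is what differentiation under the integral sign requires. The decay
    comes from [e^(r t) >= 1 + (r t)^2 / 2] and [r t >= t0 r], while [e^(a t)] is at most
    [e^(t1 |a|)]. *)
Lemma kern_bound a t0 t1 : 0 < t0 -> exists2 K, 0 <= K &
  forall t y, t0 <= t <= t1 -> modulus (kern a t y) <= lorentz K y.
Proof.
move=> t00; have [c c0 hc] := inv_radius2_le.
exists (expR (t1 * `|a|) * (2 / t0 ^+ 2 * c)) => [|t y /andP[t0t tt1]].
  by rewrite mulr_ge0 ?expR_ge0// mulr_ge0 ?ltW// divr_gt0// exprn_gt0.
have tp : 0 < t by rewrite (lt_le_trans t00).
rewrite modulus_kern mulrBl expRD /lorentz -[leRHS]mulrA.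
apply: ler_pM; rewrite ?expR_ge0//.
  rewrite ler_expR mulrC (le_trans (ler_norm _))// normrM gtr0_norm//.
  by rewrite ler_wpM2r.
rewrite expRN -[leRHS]mulrA (@le_trans _ _ (2 / t0 ^+ 2 * (r y ^+ 2)^-1))//; last first.
  by rewrite ler_wpM2l// divr_ge0// sqr_ge0.
rewrite -mulrA -invfM -exprMn -[leLHS]mul1r ler_pdivrMr ?expR_gt0//.
rewrite mulrAC ler_pdivlMr ?exprn_gt0 ?mulr_gt0 ?radius_gt0// mul1r.
have rt0 : 0 <= r y * t by rewrite mulr_ge0 ?ltW ?radius_gt0.
have := expR_ge1Dxn 1 rt0; rewrite -[(2)`!%:R]/(2 : R).
have : (t0 * r y) ^+ 2 <= (r y * t) ^+ 2.
  have h3 : t0 * r y <= r y * t by rewrite mulrC ler_pM2l ?radius_gt0.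
  have h4 : 0 <= t0 * r y by rewrite mulr_ge0// ltW// radius_gt0.
  by nra.
lra.
Qed.

End Hyperbola.

(** * Derivatives of complex-valued functions of a real variable *)

Section ComplexDerivative.
Context {R : realType}.
Local Notation C := R[i].
Local Notation Re := (@complex.Re R).
Local Notation Im := (@complex.Im R).
Implicit Types (F : R -> C) (z : C) (y : R).

Definition cderive F y z :=
  is_derive y 1 (Re \o F) (Re z) /\ is_derive y 1 (Im \o F) (Im z).

Lemma cderive_mulr F y z c : cderive F y z -> cderive (fun y => F y * c) y (z * c).
Proof.
move=> [d1 d2]; split.
  rewrite (_ : _ \o _ = fun y => Re c * (Re \o F) y - Im c * (Im \o F) y).
    apply: is_derive_eq (is_derive_fB (is_derive_fZ _ d1) (is_derive_fZ _ d2)) _.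
    by rewrite Re_mul; ring.
  by apply/funext => u /=; rewrite Re_mul; ring.
rewrite (_ : _ \o _ = fun y => Im c * (Re \o F) y + Re c * (Im \o F) y).
  apply: is_derive_eq (is_derive_fD (is_derive_fZ _ d1) (is_derive_fZ _ d2)) _.
  by rewrite Im_mul; ring.
by apply/funext => u /=; rewrite Im_mul; ring.
Qed.

Lemma cderive_cexp F y z : cderive F y z ->
  cderive (fun y => cexp (F y)) y (cexp (F y) * z).
Proof.
move=> [d1 d2].
have e := is_derive1_comp (is_derive_expR (Re (F y))) d1.
have s := is_derive1_comp (is_derive_sin (Im (F y))) d2.
have c := is_derive1_comp (is_derive_cos (Im (F y))) d2.
split.
  rewrite (_ : _ \o _ = fun y => (expR \o (Re \o F)) y * (cos \o (Im \o F)) y).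
    by apply: is_derive_eq (is_derive_fM e c) _; rewrite Re_mul cexpE /=; ring.
  by apply/funext => u; rewrite /comp cexpE.
rewrite (_ : _ \o _ = fun y => (expR \o (Re \o F)) y * (sin \o (Im \o F)) y).
  by apply: is_derive_eq (is_derive_fM e s) _; rewrite Im_mul cexpE /=; ring.
by apply/funext => u; rewrite /comp cexpE.
Qed.

Lemma cderive_real y : cderive (fun y => y%:C%C) y 1.
Proof. by split; [exact: is_derive_id|exact: is_derive_cst]. Qed.

End ComplexDerivative.

(** * Integrals over the line of complex-valued functions *)

Section ComplexIntegral.
Context {R : realType}.
Local Notation C := R[i].
Local Notation Re := (@complex.Re R).
Local Notation Im := (@complex.Im R).
Local Notation leb := (@lebesgue_measure R).
Implicit Types (f g F : R -> C) (y : R).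

Definition cint f : C :=
  Complex (\int[leb]_y Re (f y)) (\int[leb]_y Im (f y)).

(** Continuity provides measurability, and the bound integrability, of both parts. *)
Definition lorentzian f := ccontinuous f /\
  exists K, forall y, modulus (f y) <= lorentz K y.

Lemma lorentzian_integrable f : lorentzian f ->
  leb.-integrable [set: R] (EFin \o (Re \o f)) /\
  leb.-integrable [set: R] (EFin \o (Im \o f)).
Proof.
move=> [[f1 f2] [K fK]]; split; apply: (@dominated_integrable _ _ K) => // y.
  exact: le_trans (abs_Re_le _) (fK y).
exact: le_trans (abs_Im_le _) (fK y).
Qed.

Lemma cintZ f (c : C) : lorentzian f -> cint (fun y => c * f y) = c * cint f.
Proof.
move=> /lorentzian_integrable[i1 i2].
have z (k : R) (g : R -> R) : leb.-integrable [set: R] (EFin \o g) ->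
    leb.-integrable [set: R] (EFin \o (fun y => k * g y)).
  by move=> ig; rewrite (_ : _ \o _ = fun y => (k%:E * (EFin \o g) y)%E)//; exact: integrableZl.
apply/eqP; rewrite eq_complex; apply/andP; split; apply/eqP.
  rewrite Re_mul /= -!RintegralZl// -RintegralB//; try exact: z.
  by apply: eq_Rintegral => y _; rewrite Re_mul.
rewrite Im_mul /= -!RintegralZl// -RintegralD//; try exact: z.
by apply: eq_Rintegral => y _; rewrite Im_mul.
Qed.

Lemma cintB f g : lorentzian f -> lorentzian g ->
  cint (fun y => f y - g y) = cint f - cint g.
Proof.
move=> /lorentzian_integrable[i1 i2] /lorentzian_integrable[j1 j2].
apply/eqP; rewrite eq_complex; apply/andP; split; apply/eqP.
  rewrite Re_add Re_opp /= -RintegralB//.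
  by apply: eq_Rintegral => y _; rewrite Re_add Re_opp.
rewrite Im_add Im_opp /= -RintegralB//.
by apply: eq_Rintegral => y _; rewrite Im_add Im_opp.
Qed.

Lemma lorentz_harmonic (K : R) (n : nat) : 0 <= K -> lorentz K n.+1%:R <= K * harmonic n.
Proof.
move=> K0; rewrite ler_wpM2l// lef_pV2 ?posrE ?lorentz_gt0//.
have := ler0n R n; rewrite -natr1; nra.
Qed.

(** The primitive vanishes at both ends of the line, so its total variation, which is the integral,
    is zero. *)
Lemma lorentzian_primitive f F K : lorentzian f -> (forall y, cderive F y (f y)) ->
  (forall y, modulus (F y) <= lorentz K y) -> cint f = 0.
Proof.
move=> lf dF FK; have [[f1 f2] _] := lf; have [i1 i2] := lorentzian_integrable lf.
have K0 : 0 <= K.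
  by have := le_trans (modulus_ge0 _) (FK 0); rewrite /lorentz expr0n addr0 divr1.
(* Both parts are treated at once, here and in later proofs: [p] stands for [Re] or [Im]. *)
have c (p : C -> R) : (forall z, `|p z| <= modulus z) ->
    p (F n.+1%:R) - p (F (- n.+1%:R)) @[n --> \oo] --> 0.
  move=> pm; apply: norm_cvg0.
  have h : 2 * K * harmonic n @[n --> \oo] --> 2 * K * 0 by apply: cvgMl_tmp; exact: cvg_harmonic.
  rewrite mulr0 in h; apply: squeeze_cvgr (cvg_cst 0) h.
  apply: nearW => n; rewrite normr_ge0 /= (le_trans (ler_normB _ _))//.
  rewrite -mulrA mulr_natl mulr2n lerD// (le_trans (pm _))// (le_trans (FK _))//.
    exact: lorentz_harmonic.
  by rewrite {1}/lorentz sqrrN; exact: lorentz_harmonic.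
apply/eqP; rewrite eq_complex; apply/andP; split; apply/eqP => /=.
  apply: (Rintegral_FTC (F := Re \o F)) => //; first by move=> y; have [] := dF y.
  by apply: c => z; exact: abs_Re_le.
apply: (Rintegral_FTC (F := Im \o F)) => //; first by move=> y; have [] := dF y.
by apply: c => z; exact: abs_Im_le.
Qed.

End ComplexIntegral.

(** * The residue integral does not depend on time *)

Section ResidueIntegral.
Context {R : realType}.
Local Notation C := R[i].
Local Notation Re := (@complex.Re R).
Local Notation Im := (@complex.Im R).
Local Notation leb := (@lebesgue_measure R).
Variables (nu sig : R).
Hypotheses (nu0 : 0 < nu) (sig0 : 0 < sig).
Implicit Types (a y t : R).
Local Notation w a := (hyperbola a nu sig).
Local Notation dw := (dhyperbola nu sig).
Local Notation kern_ a := (kern nu sig a).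

Lemma cderive_hyperbola a y : cderive (w a) y (dw y).
Proof. by split; [exact: is_derive_Re_hyperbola|exact: is_derive_Im_hyperbola]. Qed.

Lemma cderive_kern_arc a t y : cderive (kern_ a t) y (kern_ a t y * (dw y * t%:C%C)).
Proof. by apply: cderive_cexp; apply: cderive_mulr; exact: cderive_hyperbola. Qed.

Lemma cderive_kern_time a t y : cderive (fun t => kern_ a t y) t (kern_ a t y * w a y).
Proof.
rewrite /kern; apply: (@cderive_cexp _ (fun t => w a y * t%:C%C)).
rewrite (_ : (fun _ => _) = fun t => t%:C%C * w a y); last by apply/funext => u; rewrite mulrC.
by rewrite -{2}[w a y]mul1r; apply: cderive_mulr; exact: cderive_real.
Qed.

Lemma kern_dw_bound a t0 t1 : 0 < t0 -> exists2 K, 0 <= K &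
  forall t y, t0 <= t <= t1 -> modulus (kern_ a t y * dw y) <= lorentz K y.
Proof.
move=> t00; have [K K0 hK] := kern_bound sig nu0 a t1 t00.
exists ((1 + sig) * K) => [|t y ht]; first by rewrite mulr_ge0// addr_ge0// ltW.
rewrite modulusM /lorentz -[leRHS]mulrA mulrC ler_pM ?modulus_ge0//; last exact: hK.
exact: modulus_dhyperbola.
Qed.

Lemma lorentzian_kern_dw a t : 0 < t -> lorentzian (fun y => kern_ a t y * dw y).
Proof.
move=> t0; split.
  by apply: ccontinuousM; [exact: ccontinuous_kern|exact: ccontinuous_dhyperbola].
by have [K _ hK] := kern_dw_bound a t t0; exists K => y; apply: hK; rewrite lexx.
Qed.

(** The integrand has the primitive [e^(t w) / t], which decays at both ends. *)
Lemma cint_kern_dw a t : 0 < t -> cint (fun y => kern_ a t y * dw y) = 0.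
Proof.
move=> t0; have [K K0 hK] := kern_bound sig nu0 a t t0.
apply: (lorentzian_primitive (F := fun y => kern_ a t y * (t^-1)%:C%C) (K := t^-1 * K)).
- exact: lorentzian_kern_dw.
- move=> y; have := cderive_mulr (t^-1)%:C%C (cderive_kern_arc a t y).
  have tV : t%:C%C * (t^-1)%:C%C = 1.
    by rewrite -[RHS](rmorph1 (real_complex R)) -(divff (lt0r_neq0 t0)) [RHS]rmorphM.
  by rewrite -[X in cderive _ _ X]mulrA -[X in _ * X]mulrA tV mulr1.
- move=> y; rewrite modulusM mulrC /lorentz -mulrA.
  rewrite {1}/modulus /= expr0n addr0 sqrtr_sqr ger0_norm ?invr_ge0 ?(ltW t0)//.
  by rewrite ler_wpM2l ?invr_ge0 ?(ltW t0)//; apply: hK; rewrite lexx.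
Qed.

(** The integrand of [e^(t w) dw / w] along the curve, with its simple pole at 0. *)
Definition residue_kern a t y : C := kern_ a t y * (dw y / w a y).

Lemma residue_bound a t0 t1 : a != nu -> 0 < t0 -> exists2 K, 0 <= K &
  forall t y, t0 <= t <= t1 -> modulus (residue_kern a t y) <= lorentz K y.
Proof.
move=> anu t00; have [K K0 hK] := kern_dw_bound a t1 t00.
have [m m0 hm] := modulus_hyperbola_ge nu0 sig0 anu.
(* The denominator satisfies [|w| >= m r >= m nu]. *)
exists ((m * nu)^-1 * K) => [|t y ht]; first by rewrite mulr_ge0// invr_ge0 mulr_ge0// ltW.
rewrite /residue_kern mulrA modulusM modulusV mulrC /lorentz -[leRHS]mulrA.
rewrite ler_pM ?modulus_ge0 ?invr_ge0 ?modulus_ge0//; last exact: hK.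
rewrite lef_pV2 ?posrE ?mulr_gt0 ?modulus_gt0 ?hyperbola_neq0//.
by rewrite (le_trans _ (hm y))// ler_pM2l// radius_ge.
Qed.

Lemma ccontinuous_dlog a : a != nu -> ccontinuous (fun y => dw y / w a y).
Proof.
move=> anu; apply: ccontinuousM; first exact: ccontinuous_dhyperbola.
by apply: ccontinuousV; [exact: ccontinuous_hyperbola|exact: hyperbola_neq0].
Qed.

Lemma lorentzian_residue a t : a != nu -> 0 < t -> lorentzian (residue_kern a t).
Proof.
move=> anu t0; split.
  by apply: ccontinuousM; [exact: ccontinuous_kern|exact: ccontinuous_dlog].
by have [K _ hK] := residue_bound t anu t0; exists K => y; apply: hK; rewrite lexx.
Qed.

Definition residue_int a t : C := cint (residue_kern a t).

(** The factor [w] produced by differentiating [e^(t w)] in [t] cancels the pole. *)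
Lemma cderive_residue a t y : a != nu ->
  cderive (fun t => residue_kern a t y) t (kern_ a t y * dw y).
Proof.
move=> anu; have := cderive_mulr (dw y / w a y) (cderive_kern_time a t y).
rewrite (_ : _ * w a y * _ = kern_ a t y * dw y)//.
by field; exact: hyperbola_neq0.
Qed.

(** Differentiation under the integral sign on []t / 2, 2 t[], an interval that stays away from 0,
    so that one majorant of the time derivative serves throughout. *)
Lemma derive_residue_part a t (p : C -> R) : a != nu -> 0 < t ->
  (forall z, `|p z| <= modulus z) ->
  (forall y t, is_derive t 1 (fun t => p (residue_kern a t y)) (p (kern_ a t y * dw y))) ->
  (forall t, 0 < t -> leb.-integrable [set: R] (EFin \o (fun y => p (residue_kern a t y)))) ->
  \int[leb]_y p (kern_ a t y * dw y) = 0 ->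
  is_derive t 1 (fun t => \int[leb]_y p (residue_kern a t y)) 0.
Proof.
move=> anu t0 pm dp ip p0.
have [K K0 hK] := kern_dw_bound a (2 * t) (divr_gt0 t0 (ltr0n _ 2)).
have It : `]t / 2, 2 * t[%classic t by rewrite /= in_itv/=; lra.
have sub u : `]t / 2, 2 * t[%classic u -> t / 2 <= u <= 2 * t /\ 0 < u.
  by rewrite /= in_itv/= => /andP[u1 u2]; lra.
have h1 u : `]t / 2, 2 * t[%classic u ->
    leb.-integrable [set: R] (EFin \o (fun y => p (residue_kern a u y))).
  by move=> /sub[_]; exact: ip.
have h2 (u y : R) : `]t / 2, 2 * t[%classic u -> [set: R] y ->
    derivable ((fun u y => p (residue_kern a u y)) ^~ y) u 1.
  by move=> _ _; exact: ex_derive.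
have h3 (u y : R) : `]t / 2, 2 * t[%classic u -> [set: R] y ->
    `|partial1of2 (fun u y => p (residue_kern a u y)) u y| <= lorentz K y.
  move=> /sub[tu _] _; rewrite partial1of2E derive_val.
  by rewrite (le_trans (pm _))// hK.
have K1 y : 0 <= lorentz K y by rewrite divr_ge0// ltW// lorentz_gt0.
have iK := integrable_lorentz K.
apply: DeriveDef.
  exact: (derivable_under_integral measurableT It h1 h2 K1 iK h3).
rewrite -derive1E (differentiation_under_integral measurableT It h1 h2 K1 iK h3).
rewrite -[RHS]p0; apply: eq_Rintegral => y _.
by rewrite partial1of2E derive_val.
Qed.

Lemma residue_int_cst a t : a != nu -> 0 < t -> residue_int a t = residue_int a 1.
Proof.
move=> anu t0.
suff c (p : C -> R) : (forall z, `|p z| <= modulus z) ->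
  (forall y t, is_derive t 1 (fun t => p (residue_kern a t y)) (p (kern_ a t y * dw y))) ->
  (forall t, 0 < t -> leb.-integrable [set: R] (EFin \o (fun y => p (residue_kern a t y)))) ->
  (forall t, 0 < t -> \int[leb]_y p (kern_ a t y * dw y) = 0) ->
  \int[leb]_y p (residue_kern a t y) = \int[leb]_y p (residue_kern a 1 y).
  have z u : 0 < u -> cint (fun y => kern_ a u y * dw y) = 0 by exact: cint_kern_dw.
  congr Complex; apply: c.
  - exact: abs_Re_le.
  - by move=> y u; have [] := cderive_residue u y anu.
  - by move=> u u0; have [] := lorentzian_integrable (lorentzian_residue anu u0).
  - by move=> u /z[].
  - exact: abs_Im_le.
  - by move=> y u; have [] := cderive_residue u y anu.
  - by move=> u u0; have [] := lorentzian_integrable (lorentzian_residue anu u0).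
  - by move=> u /z[].
move=> pm dp ip p0.
pose G u := \int[leb]_y p (residue_kern a u y).
(* Writing [t = e^u] turns the open half line into the whole line, where a zero derivative forces
   constancy; [u = 0] corresponds to [t = 1]. *)
have dG (u : R) : is_derive u 1 (G \o expR) 0.
  have d := derive_residue_part anu (expR_gt0 u) pm dp ip (p0 _ (expR_gt0 u)).
  by apply: is_derive_eq (is_derive1_comp d (is_derive_expR u)) _; rewrite mul0r.
have := is_derive_0_is_cst (ln t) 0 dG.
by rewrite /= expR0 lnK.
Qed.

End ResidueIntegral.

(** * The residue integral as zero, or as an integral of logarithmic derivatives *)

Section ResidueValue.
Context {R : realType}.
Local Notation C := R[i].
Local Notation Re := (@complex.Re R).
Local Notation Im := (@complex.Im R).
Local Notation leb := (@lebesgue_measure R).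
Variables (nu sig : R).
Hypotheses (nu0 : 0 < nu) (sig0 : 0 < sig).
Implicit Types (a y t : R).
Local Notation w a := (hyperbola a nu sig).
Local Notation dw := (dhyperbola nu sig).
Local Notation kern_ a := (kern nu sig a).
Local Notation r y := (Num.sqrt (nu ^+ 2 + y ^+ 2)).

Lemma cvg_le_geometric0 (u : nat -> R) (K q : R) : 0 <= q < 1 ->
  (forall n, `|u n| <= K * q ^+ n) -> u n @[n --> \oo] --> 0.
Proof.
move=> /andP[q0 q1] uK; apply: norm_cvg0.
have h : K * q ^+ n @[n --> \oo] --> K * 0.
  by apply: cvgMl_tmp; apply: cvg_expr; rewrite ger0_norm.
rewrite mulr0 in h; apply: squeeze_cvgr (cvg_cst 0) h.
by apply: nearW => n; rewrite normr_ge0 uK.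
Qed.

(** On the curve [Re w <= a - nu < 0], so at time [n + 1] the integral is of order [e^(n (a - nu))],
    yet it is constant in time. *)
Lemma residue_int_out a : a < nu -> residue_int nu sig a 1 = 0.
Proof.
move=> anu; have an : a != nu by rewrite lt_eqF.
have [K K0 hK] := residue_bound nu0 sig0 1 an ltr01.
have q1 : 0 <= expR (a - nu) < 1 by rewrite expR_ge0 expR_lt1 subr_lt0.
have b n y : modulus (residue_kern nu sig a n.+1%:R y) <= lorentz (expR (a - nu) ^+ n * K) y.
  rewrite /lorentz -[leRHS]mulrA.
  have E : modulus (residue_kern nu sig a n.+1%:R y) =
      expR ((a - r y) * n%:R) * modulus (residue_kern nu sig a 1 y).
    rewrite /residue_kern modulusM [in RHS]modulusM [RHS]mulrA; congr (_ * _).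
    by rewrite !modulus_kern mulr1 -expRD -natr1 mulrDr mulr1.
  rewrite E ler_pM ?expR_ge0 ?modulus_ge0//; last by rewrite hK// lexx.
  by rewrite -expRM_natr ler_expR ler_wpM2r// lerB// radius_ge.
have c (p : C -> R) : (forall z, `|p z| <= modulus z) ->
    (forall t, 0 < t -> continuous (fun y => p (residue_kern nu sig a t y))) ->
    (forall t, 0 < t -> \int[leb]_y p (residue_kern nu sig a t y) =
                        \int[leb]_y p (residue_kern nu sig a 1 y)) ->
    \int[leb]_y p (residue_kern nu sig a 1 y) = 0.
  move=> pm pc pE.
  apply: (@cvg_unique _ _ ((fun=> \int[leb]_y p (residue_kern nu sig a 1 y)) @ \oo)) => //.
    exact: cvg_cst.
  apply: (@cvg_le_geometric0 _ (\int[leb]_y lorentz K y) (expR (a - nu))) => // n.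
  rewrite -(pE n.+1%:R)//.
  rewrite (le_trans (abs_Rintegral_le (K := expR (a - nu) ^+ n * K) _ _))//.
  - exact: pc.
  - by move=> y; exact: le_trans (pm _) (b n y).
  - rewrite [leRHS]mulrC -RintegralZl//; last exact: integrable_lorentz.
    apply: le_Rintegral => //; first exact: integrable_lorentz.
      rewrite (_ : _ \o _ = EFin \o lorentz (expR (a - nu) ^+ n * K)).
        exact: integrable_lorentz.
      by apply/funext => y; rewrite /= /lorentz mulrA.
    by move=> y _; rewrite /lorentz mulrA.
have cst t : 0 < t -> residue_int nu sig a t = residue_int nu sig a 1.
  by move=> t0; exact: residue_int_cst.
have cc t : 0 < t -> ccontinuous (residue_kern nu sig a t).
  by move=> t0; have [] := lorentzian_residue nu0 sig0 an t0.
apply/eqP; rewrite eq_complex; apply/andP; split; apply/eqP; apply: c.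
- exact: abs_Re_le.
- by move=> t /cc[].
- by move=> t /cst[].
- exact: abs_Im_le.
- by move=> t /cc[].
- by move=> t /cst[].
Qed.

(** Each quotient decays only like [1 / |y|]; the difference is of order [1 / y^2], hence
    integrable. The reference curve [w 0] lies entirely in the left half plane. *)
Definition dlog a y : C := dw y / w a y - dw y / w 0 y.

Lemma dlog_bound a : a != nu -> exists K, forall y, modulus (dlog a y) <= lorentz K y.
Proof.
move=> anu; have [m m0 hm] := modulus_hyperbola_ge nu0 sig0 anu.
have nu_0 : 0 != nu by rewrite lt_eqF.
have [k k0 hk] := modulus_hyperbola_ge nu0 sig0 nu_0.
have [c c0 hc] := inv_radius2_le nu0.
exists ((1 + sig) * `|a| / (m * k) * c) => y.
(* Since [w a - w 0 = a], the numerator over the common denominator is a constant times [dw]; each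
   denominator then contributes a factor [1 / r]. *)
have E : dlog a y = - (dw y * a%:C%C * (w a y)^-1 * (w 0 y)^-1).
  rewrite /dlog (_ : w 0 y = w a y - a%:C%C).
    have := hyperbola_neq0 nu0 sig0 nu_0 y; have := hyperbola_neq0 nu0 sig0 anu y.
    rewrite (_ : w 0 y = w a y - a%:C%C); first by move=> h1 h2; field; rewrite h1 h2.
    by apply/eqP; rewrite eq_complex /= oppr0 addr0 addrAC subrr !eqxx.
  by apply/eqP; rewrite eq_complex /= oppr0 addr0 addrAC subrr !eqxx.
have N z : modulus (- z) = modulus z by rewrite /modulus Re_opp Im_opp !sqrrN.
rewrite E N !modulusM !modulusV.
have -> : modulus a%:C%C = `|a| by rewrite /modulus /= expr0n addr0 sqrtr_sqr.
have rp := radius_gt0 nu0 y.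
rewrite /lorentz -[leRHS]mulrA.
rewrite (@le_trans _ _ ((1 + sig) * `|a| / (m * k) * (r y ^+ 2)^-1))//; last first.
  rewrite ler_wpM2l// mulr_ge0 ?mulr_ge0 ?invr_ge0 ?addr_ge0 ?mulr_ge0//; exact: ltW.
rewrite (_ : (1 + sig) * `|a| / (m * k) * (r y ^+ 2)^-1 =
  (1 + sig) * `|a| * (m * r y)^-1 * (k * r y)^-1); last by field; rewrite !gt_eqF.
have v x (b s : R) : b != nu -> 0 < s -> s * r x <= modulus (w b x) ->
    (modulus (w b x))^-1 <= (s * r x)^-1.
  move=> bnu s0 hs; have s1 : 0 < s * r x by rewrite mulr_gt0// radius_gt0.
  by rewrite lef_pV2 ?posrE// (lt_le_trans s1).
apply: ler_pM; rewrite ?mulr_ge0 ?invr_ge0 ?modulus_ge0 ?v//.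
apply: ler_pM; rewrite ?mulr_ge0 ?invr_ge0 ?modulus_ge0 ?v//.
by apply: ler_wpM2r => //; exact: modulus_dhyperbola.
Qed.

Lemma lorentzian_dlog a : a != nu -> lorentzian (dlog a).
Proof.
move=> anu; split; last exact: dlog_bound.
have nu_0 : 0 != nu by rewrite lt_eqF.
rewrite (_ : dlog a = fun y => dw y / w a y + (-1) * (dw y / w 0 y)).
  apply: ccontinuousD; first exact: ccontinuous_dlog.
  by apply: ccontinuousM; [exact: ccontinuous_cst|exact: ccontinuous_dlog].
by apply/funext => y; rewrite mulN1r.
Qed.

Lemma kern_shift a t y : kern_ a t y = (expR (a * t))%:C%C * kern_ 0 t y.
Proof.
rewrite /kern (_ : w a y * t%:C%C = (a * t)%:C%C + w 0 y * t%:C%C).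
  by rewrite cexpD {1}/cexp /= cos0 sin0 mulr1.
apply/eqP; rewrite eq_complex Re_add Im_add !Re_mul !Im_mul /=.
by apply/andP; split; apply/eqP; ring.
Qed.

(* Since [residue_int 0 1] vanishes, letting [t] tend to 0 in
   [e^(a t) * int kern 0 t * (w_a' / w_a - w_0' / w_0) = residue_int a 1]. *)
Lemma residue_int_dlog a : a != nu -> residue_int nu sig a 1 = cint (dlog a).
Proof.
move=> anu; have nu_0 : 0 != nu by rewrite lt_eqF.
have [K hK] := dlog_bound anu; have [[k1 k2] _] := lorentzian_dlog anu.
pose t_ (n : nat) : R := harmonic n.
have t0 n : 0 < t_ n by rewrite invr_gt0.
have tc : t_ n @[n --> \oo] --> 0 by exact: cvg_harmonic.
pose f n y := kern_ 0 (t_ n) y * dlog a y.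
have cf n : ccontinuous (f n).
  by apply: ccontinuousM; [exact: ccontinuous_kern|split].
(* The real part of [w 0] is negative, so [e^(t w)] has modulus at most 1 and the majorant survives
   the limit [t] to 0. *)
have fK n y : modulus (f n y) <= lorentz K y.
  rewrite modulusM modulus_kern (le_trans _ (hK y))// ler_piMl ?modulus_ge0//.
  by rewrite -expR0 ler_expR sub0r mulNr oppr_le0 mulr_ge0 ?sqrtr_ge0// ltW// t0.
have lf n : lorentzian (f n) by split => //; exists K.
have fE n : (expR (a * t_ n))%:C%C * cint (f n) = residue_int nu sig a 1.
  have h0 := lorentzian_residue nu0 sig0 nu_0 (t0 n).
  have ha := lorentzian_residue nu0 sig0 anu (t0 n).
  rewrite -cintZ//.
  rewrite (_ : (fun y => _) = fun y => residue_kern nu sig a (t_ n) y -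
      (expR (a * t_ n))%:C%C * residue_kern nu sig 0 (t_ n) y).
    rewrite cintB//; last first.
      split; first by apply: ccontinuousM; [exact: ccontinuous_cst|case: h0].
      case: h0 => _ [M hM]; exists (expR (a * t_ n) * M) => y.
      rewrite modulusM /lorentz -mulrA {1}/modulus /= expr0n addr0 sqrtr_sqr.
      by rewrite ger0_norm ?expR_ge0// ler_wpM2l ?expR_ge0.
    rewrite cintZ// -[cint (residue_kern nu sig a _)]/(residue_int nu sig a _).
    rewrite -[cint (residue_kern nu sig 0 _)]/(residue_int nu sig 0 _).
    rewrite (residue_int_cst nu0 sig0 anu (t0 n)) (residue_int_cst nu0 sig0 nu_0 (t0 n)).
    by rewrite (residue_int_out nu0) mulr0 subr0.
  apply/funext => y; rewrite /f /residue_kern (kern_shift a) /dlog.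
  by rewrite !mulrBr !mulrA.
have e1 : expR (a * t_ n) @[n --> \oo] --> (1 : R).
  rewrite -(expR0 R) -[X in expR X](mulr0 a).
  apply: (cvg_comp _ expR _ (@continuous_expR R _)).
  exact: cvgMl_tmp.
have c (p : C -> R) : (forall z, `|p z| <= modulus z) ->
    (forall n, continuous (fun y => p (f n y))) -> continuous (fun y => p (dlog a y)) ->
    (forall y, p (f n y) @[n --> \oo] --> p (dlog a y)) ->
    (forall n, expR (a * t_ n) * \int[leb]_y p (f n y) = p (residue_int nu sig a 1)) ->
    p (residue_int nu sig a 1) = \int[leb]_y p (dlog a y).
  move=> pm pf pk pc pE.
  have h : \int[leb]_y p (f n y) @[n --> \oo] --> \int[leb]_y p (dlog a y).
    apply: (dominated_cvg_Rintegral (K := K)) => // n y.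
    exact: le_trans (pm _) (fK n y).
  have {h} := cvgM e1 h; rewrite mul1r.
  rewrite (_ : _ \* _ = fun=> p (residue_int nu sig a 1)); last by apply/funext => n; exact: pE.
  by move=> /(_ _) h; exact: (cvg_unique _ (cvg_cst _) h).
have kc y : Re (kern_ 0 (t_ n) y) @[n --> \oo] --> (1 : R) /\
            Im (kern_ 0 (t_ n) y) @[n --> \oo] --> (0 : R).
  have [d1 d2] := cderive_kern_time nu sig 0 0 y.
  have k0 : kern_ 0 0 y = 1.
    by rewrite /kern mulr0 /cexp /= expR0 cos0 sin0 mulr1.
  have cts (g : R -> R) (l : R) : is_derive (0 : R) 1 g l -> g (t_ n) @[n --> \oo] --> g 0.
    move=> dg; have cg : {for (0 : R), continuous g}.
      by apply/differentiable_continuous/derivable1_diffP; exact: ex_derive.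
    exact: (cvg_comp _ g tc cg).
  by split; [have := cts _ _ d1|have := cts _ _ d2]; rewrite [X in _ --> X]/comp k0.
apply/eqP; rewrite eq_complex; apply/andP; split; apply/eqP; apply: c.
- exact: abs_Re_le.
- by move=> n; have [] := cf n.
- exact: k1.
- move=> y; have [kr ki] := kc y.
  rewrite (_ : (fun _ => _) = fun n => Re (kern_ 0 (t_ n) y) * Re (dlog a y) -
      Im (kern_ 0 (t_ n) y) * Im (dlog a y)); last by apply/funext => n; rewrite Re_mul.
  rewrite -[X in _ --> X]mul1r -[X in _ --> X]subr0 -[X in _ --> _ - X](mul0r (Im (dlog a y))).
  by apply: cvgB; exact: cvgMr_tmp.
- by move=> n; rewrite -(fE n) Re_mul /= mul0r subr0.
- exact: abs_Im_le.
- by move=> n; have [] := cf n.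
- exact: k2.
- move=> y; have [kr ki] := kc y.
  rewrite (_ : (fun _ => _) = fun n => Re (kern_ 0 (t_ n) y) * Im (dlog a y) +
      Im (kern_ 0 (t_ n) y) * Re (dlog a y)); last by apply/funext => n; rewrite Im_mul.
  rewrite -[X in _ --> X]mul1r -[X in _ --> X]addr0 -[X in _ --> _ + X](mul0r (Re (dlog a y))).
  by apply: cvgD; exact: cvgMr_tmp.
- by move=> n; rewrite -(fE n) Im_mul /= mul0r addr0.
Qed.

End ResidueValue.

(** * The variation of the logarithm along the hyperbola *)

Section WindingNumber.
Context {R : realType}.
Local Notation C := R[i].
Local Notation Re := (@complex.Re R).
Local Notation Im := (@complex.Im R).
Variables (nu sig : R).
Hypotheses (nu0 : 0 < nu) (sig0 : 0 < sig).
Implicit Types (a y : R).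
Local Notation w a := (hyperbola a nu sig).
Local Notation dw := (dhyperbola nu sig).
Local Notation r y := (Num.sqrt (nu ^+ 2 + y ^+ 2)).

Lemma Re_div (z v : C) : Re (z / v) = (Re v * Re z + Im v * Im z) / (Re v ^+ 2 + Im v ^+ 2).
Proof.
rewrite Re_mul Re_inv Im_inv mulrDl mulNr mulrN opprK.
by congr (_ + _); rewrite mulrCA mulrA.
Qed.

Lemma Im_div (z v : C) : Im (z / v) = (Re v * Im z - Im v * Re z) / (Re v ^+ 2 + Im v ^+ 2).
Proof.
rewrite Im_mul Re_inv Im_inv mulrBl addrC mulNr mulrN.
by congr (_ - _); rewrite mulrCA mulrA.
Qed.

Lemma sqr_modulus_hyperbola_gt0 a y : a != nu -> 0 < Re (w a y) ^+ 2 + Im (w a y) ^+ 2.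
Proof. by move=> anu; rewrite -sqr_modulus exprn_gt0// modulus_gt0 hyperbola_neq0. Qed.

(** The integral is the variation of a logarithm of [w a / w 0]. Its real part is even in [y] and
    contributes nothing, while the argument increases by a full turn. *)
Lemma cint_dlog a : nu < a -> cint (dlog nu sig a) = Complex 0 (2 * pi).
Proof.
move=> nua; have anu : a != nu by rewrite gt_eqF.
have nu_0 : 0 != nu by rewrite lt_eqF.
have a0 : 0 < a by exact: lt_trans nua.
have [[k1 k2] _] := lorentzian_dlog nu0 sig0 anu.
have [i1 i2] := lorentzian_integrable (lorentzian_dlog nu0 sig0 anu).
congr Complex.
  pose L b y := ln ((Re \o w b) y ^+ 2 + (Im \o w b) y ^+ 2) / 2.
  apply: (Rintegral_FTC (F := fun y => L a y - L 0 y) k1 i1) => [y|].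
    rewrite -[X in is_derive _ _ _ X]/(Re (dlog nu sig a y)) /dlog Re_add Re_opp !Re_div.
    have d b : b != nu -> is_derive y 1 (L b) _ := fun bnu =>
      is_derive_ln_modulus (is_derive_Re_hyperbola sig nu0 b y)
        (is_derive_Im_hyperbola nu sig b y) (sqr_modulus_hyperbola_gt0 y bnu).
    exact: is_derive_fB (d a anu) (d 0 nu_0).
  have even b y : L b (- y) = L b y by rewrite /L /= sqrrN mulrN sqrrN.
  under eq_fun do rewrite !even subrr.
  exact: cvg_cst.
(* [P + i Q] is minus [w a] times the conjugate of [w 0], whose argument differs from that of
   [w a / w 0] by a half turn. It avoids the negative real axis: [Q] vanishes only at [y = 0], where
   [P = nu (a - nu) > 0]. Its principal argument is therefore smooth on the whole line, and odd. *)
pose P y := -1 * ((Re \o w a) y * (Re \o w 0) y + (Im \o w 0) y ^+ 2).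
pose Q y := a * (Im \o w 0) y.
have PQ y : P y ^+ 2 + Q y ^+ 2 =
    (Re (w a y) ^+ 2 + Im (w a y) ^+ 2) * (Re (w 0 y) ^+ 2 + Im (w 0 y) ^+ 2).
  by rewrite /P /Q /=; ring.
have PQ0 y : 0 < Num.sqrt (P y ^+ 2 + Q y ^+ 2) + P y.
  have [->|y0] := eqVneq y 0.
    rewrite ltr_wpDl ?sqrtr_ge0// /P /= mulr0 !expr0n !addr0 sqrtr_sqr gtr0_norm// sub0r.
    by rewrite mulN1r mulrN opprK mulr_gt0// subr_gt0.
  have Q0 : 0 < Q y ^+ 2.
    by rewrite exprn_even_gt0//= mulf_neq0 ?(gt_eqF a0)// mulf_neq0 ?(gt_eqF sig0).
  rewrite -ltrBlDr sub0r (le_lt_trans (ler_norm _))// normrN -sqrtr_sqr.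
  by rewrite ltr_sqrt ?ltrDl// ltr_wpDl ?sqr_ge0.
pose H y := Q y / (Num.sqrt (P y ^+ 2 + Q y ^+ 2) + P y).
apply: (Rintegral_FTC (F := fun y => 2 * atan (H y)) k2 i2) => [y|].
  have da := is_derive_Re_hyperbola sig nu0 a y.
  have d0 := is_derive_Re_hyperbola sig nu0 0 y.
  have di := is_derive_Im_hyperbola nu sig 0 y.
  have dP := is_derive_fZ (-1) (is_derive_fD (is_derive_fM da d0) (is_derive_fX2 di)).
  apply: is_derive_eq (is_derive_arg (dP : is_derive y 1 P _) (is_derive_fZ a di) (PQ0 y)) _.
  rewrite PQ -[RHS]/(Im (dlog nu sig a y)) /dlog Im_add Im_opp !Im_div.
  have := sqr_modulus_hyperbola_gt0 y anu; have := sqr_modulus_hyperbola_gt0 y nu_0.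
  rewrite /P /Q /= (_ : a - r y = a + (0 - r y)); last by ring.
  move: (0 - r y) (sig * y) (y / r y) => X Y X' h1 h2.
  by field; rewrite (gt_eqF h1) (gt_eqF h2).
have odd y : H (- y) = - H y.
  have evenP : P (- y) = P y by rewrite /P /= sqrrN mulrN sqrrN.
  have oddQ : Q (- y) = - Q y by rewrite /Q /= !mulrN.
  by rewrite /H evenP oddQ sqrrN mulNr.
have -> : (2 * pi : R) = 4 * (pi / 2) by field.
rewrite (_ : (fun _ => _) = fun n => 4 * atan (H n.+1%:R)); last first.
  by apply/funext => n; rewrite odd atanN; ring.
apply: cvgMl_tmp; apply: (cvg_comp _ (@atan R) _ (@cvgy_atan R)).
(* With [rho] the modulus of [P + i Q], [Q^2 + P (rho + P) = rho (rho + P) >= 0] gives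
   [H >= - P / Q]. Completing the square in [r] and using [y >= 1] bounds [- P] below by
   [sig^2 y^2 - a^2 y / 4], which is divided by [Q = a sig y]. *)
apply: (@ger_cvgy _ _ _ _ (fun n => n.+1%:R * (sig / a) - a / (4 * sig))).
  apply: nearW => n; set y : R := n.+1%:R.
  have y1 : 1 <= y by rewrite ler1n.
  have Q0 : 0 < Q y by rewrite !mulr_gt0// (lt_le_trans ltr01).
  apply: (@le_trans _ _ (- P y / Q y)).
    rewrite ler_pdivlMr//.
    have -> : (y * (sig / a) - a / (4 * sig)) * Q y = sig ^+ 2 * y ^+ 2 - a ^+ 2 / 4 * y.
      by rewrite /Q /=; field; rewrite !gt_eqF.
    have -> : - P y = (r y - a / 2) ^+ 2 - a ^+ 2 / 4 + sig ^+ 2 * y ^+ 2.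
      by rewrite /P /=; field.
    have : a ^+ 2 / 4 <= a ^+ 2 / 4 * y by rewrite ler_peMr// divr_ge0 ?sqr_ge0.
    by have := sqr_ge0 (r y - a / 2); lra.
  rewrite ler_pdivlMr// mulrAC ler_pdivrMr// -subr_ge0.
  set rho := Num.sqrt (P y ^+ 2 + Q y ^+ 2).
  have rho2 : rho ^+ 2 = P y ^+ 2 + Q y ^+ 2.
    by rewrite sqr_sqrtr// addr_ge0// sqr_ge0.
  have -> : Q y * Q y - - P y * (rho + P y) = rho * (rho + P y).
    have -> : Q y * Q y = rho ^+ 2 - P y ^+ 2 by rewrite rho2; ring.
    by ring.
  by rewrite mulr_ge0 ?sqrtr_ge0// ltW// PQ0.
apply/cvgryPge => A; have sa : 0 < sig / a by rewrite divr_gt0.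
have /cvgryPge/(_ ((A + a / (4 * sig)) / (sig / a))) := @cvgr_idn R.
apply: filterS => n; rewrite ler_pdivrMr// => An.
by rewrite lerBrDr (le_trans An)// ler_wpM2r ?(ltW sa)// ler_nat.
Qed.

End WindingNumber.

(** * The inner product of square-integrable functions, Bessel and Parseval *)

Section SquareIntegrable.
Context {R : realType} {d : nat} (Om : set 'rV[R]_d).
Hypothesis openOm : open Om.
Local Notation C := R[i].
Local Notation Re := (@complex.Re R).
Local Notation Im := (@complex.Im R).
Local Notation mu := (@lebesgue_Rd R d).
Local Notation D := (Om : set (Rd R d)).
Implicit Types (f g h : 'rV[R]_d -> C) (p q : Rd R d -> R) (c : C).

Let mD : measurable D. Proof. exact: open_measurable_Rd. Qed.

Let restrictD p q : (fun x => p x + q x) \_ D = p \_ D + q \_ D.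
Proof. by apply/funext => x; rewrite /patch fctE; case: ifP => // _; rewrite addr0. Qed.

Let restrictZ p (k : R) : (fun x => k * p x) \_ D = k \o* (p \_ D).
Proof. by apply/funext => x; rewrite /patch /= mulrC; case: ifP => // _; rewrite mul0r. Qed.

Let rL2D p q : p \_ D \in Lfun mu 2%:E -> q \_ D \in Lfun mu 2%:E ->
  (fun x => p x + q x) \_ D \in Lfun mu 2%:E.
Proof. by rewrite restrictD; apply: (Lfun_addr_closed mu (lee1n 2)).2. Qed.

Let rL2Z p (k : R) : p \_ D \in Lfun mu 2%:E ->
  (fun x => k * p x) \_ D \in Lfun mu 2%:E.
Proof. by rewrite restrictZ; apply: Lfun_scale; rewrite ler1n. Qed.

Let rL2M p q : p \_ D \in Lfun mu 2%:E -> q \_ D \in Lfun mu 2%:E ->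
  mu.-integrable D (EFin \o (fun x => p x * q x)).
Proof.
move=> hp hq; apply/integrable_mkcond => //.
have /Lfun1_integrable := Lfun2_mul_Lfun1 hp hq.
apply: eq_integrable => // x _; rewrite /patch /=.
by case: ifP => // _; rewrite mul0r.
Qed.

Lemma inL2D f g : inL2 Om f -> inL2 Om g -> inL2 Om (fun x => f x + g x).
Proof.
move=> [f1 f2] [g1 g2]; split.
  rewrite (_ : _ \o _ = fun x => Re (f x) + Re (g x)); first exact: rL2D.
  by apply/funext => x /=; rewrite Re_add.
rewrite (_ : _ \o _ = fun x => Im (f x) + Im (g x)); first exact: rL2D.
by apply/funext => x /=; rewrite Im_add.
Qed.

Lemma inL2Z c f : inL2 Om f -> inL2 Om (fun x => c * f x).
Proof.
move=> [f1 f2]; split.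
  rewrite (_ : _ \o _ = fun x => Re c * Re (f x) + (- Im c) * Im (f x)).
    by apply: rL2D; exact: rL2Z.
  by apply/funext => x /=; rewrite Re_mul mulNr.
rewrite (_ : _ \o _ = fun x => Re c * Im (f x) + Im c * Re (f x)).
  by apply: rL2D; exact: rL2Z.
by apply/funext => x /=; rewrite Im_mul.
Qed.

Lemma inL2B f g : inL2 Om f -> inL2 Om g -> inL2 Om (fun x => f x - g x).
Proof.
move=> lf lg; rewrite (_ : (fun _ => _) = fun x => f x + (-1) * g x).
  by apply: inL2D => //; exact: inL2Z.
by apply/funext => x; rewrite mulN1r.
Qed.

Lemma inL2_0 : inL2 Om (fun=> 0).
Proof.
have [h1 _] := Lfun_addr_closed mu (lee1n 2).
by split; rewrite (_ : _ \_ _ = 0)//; apply/funext => x; rewrite /patch /=; case: ifP.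
Qed.

Lemma inL2_sum (I : Type) (s : seq I) (P : pred I) (F : I -> 'rV[R]_d -> C) :
  (forall i, inL2 Om (F i)) -> inL2 Om (fun x => \sum_(i <- s | P i) F i x).
Proof.
move=> lF; elim: s => [|i s IH].
  rewrite (_ : (fun _ => _) = fun=> 0); first exact: inL2_0.
  by apply/funext => x; rewrite big_nil.
have [Pi|nPi] := boolP (P i).
  rewrite (_ : (fun _ => _) = fun x => F i x + \sum_(i <- s | P i) F i x).
    exact: inL2D.
  by apply/funext => x; rewrite big_cons Pi.
rewrite (_ : (fun _ => _) = fun x => \sum_(i <- s | P i) F i x)//.
by apply/funext => x; rewrite big_cons (negbTE nPi).
Qed.

Lemma Re_mulJ (z w : C) : Re (z * conjc w) = Re z * Re w + Im z * Im w.
Proof. by case: z w => ? ? [? ?] /=; rewrite mulrN opprK. Qed.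

Lemma Im_mulJ (z w : C) : Im (z * conjc w) = Im z * Re w + (-1) * (Re z * Im w).
Proof. by case: z w => ? ? [? ?] /=; ring. Qed.

Lemma ip_integrable f g : inL2 Om f -> inL2 Om g ->
  mu.-integrable D (EFin \o (fun x => Re (f x * conjc (g x)))) /\
  mu.-integrable D (EFin \o (fun x => Im (f x * conjc (g x)))).
Proof.
move=> [f1 f2] [g1 g2]; split.
  rewrite (_ : _ \o _ = (fun x => (Re (f x) * Re (g x))%:E + (Im (f x) * Im (g x))%:E)%E).
    by apply: integrableD => //; exact: rL2M.
  by apply/funext => x /=; rewrite Re_mulJ EFinD.
rewrite (_ : _ \o _ = (fun x => (Im (f x) * Re (g x))%:E + (-1)%:E * (Re (f x) * Im (g x))%:E)%E).
  apply: integrableD => //; first exact: rL2M.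
  by apply: integrableZl => //; exact: rL2M.
by apply/funext => x /=; rewrite Im_mulJ EFinD EFinM.
Qed.

Lemma ipDl f g h : inL2 Om f -> inL2 Om g -> inL2 Om h ->
  ip Om (fun x => f x + g x) h = ip Om f h + ip Om g h.
Proof.
move=> lf lg lh; have [i1 i2] := ip_integrable lf lh; have [j1 j2] := ip_integrable lg lh.
apply/eqP; rewrite eq_complex Re_add Im_add /=; apply/andP; split; apply/eqP.
  by rewrite -RintegralD//; apply: eq_Rintegral => x _; rewrite mulrDl Re_add.
by rewrite -RintegralD//; apply: eq_Rintegral => x _; rewrite mulrDl Im_add.
Qed.

Lemma ipZl c f h : inL2 Om f -> inL2 Om h -> ip Om (fun x => c * f x) h = c * ip Om f h.
Proof.
move=> lf lh; have [i1 i2] := ip_integrable lf lh.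
have z (k : R) (p : Rd R d -> R) : mu.-integrable D (EFin \o p) ->
    mu.-integrable D (EFin \o (fun y => k * p y)).
  by move=> ig; rewrite (_ : _ \o _ = fun y => (k%:E * (EFin \o p) y)%E)//; exact: integrableZl.
apply/eqP; rewrite eq_complex Re_mul Im_mul /=; apply/andP; split; apply/eqP.
  rewrite -!RintegralZl// -RintegralB//; try exact: z.
  by apply: eq_Rintegral => x _; rewrite -mulrA Re_mul.
rewrite -!RintegralZl// -RintegralD//; try exact: z.
by apply: eq_Rintegral => x _; rewrite -mulrA Im_mul.
Qed.

Lemma ipC f g : inL2 Om f -> inL2 Om g -> ip Om g f = conjc (ip Om f g).
Proof.
move=> lf lg; have [i1 i2] := ip_integrable lf lg.
rewrite /ip /=; congr Complex.
  by apply: eq_Rintegral => x _; rewrite !Re_mulJ; ring.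
rewrite -mulN1r -RintegralZl//.
by apply: eq_Rintegral => x _; rewrite !Im_mulJ; ring.
Qed.

Lemma ipBl f g h : inL2 Om f -> inL2 Om g -> inL2 Om h ->
  ip Om (fun x => f x - g x) h = ip Om f h - ip Om g h.
Proof.
move=> lf lg lh; rewrite (_ : (fun _ => _) = fun x => f x + (-1) * g x).
  by rewrite ipDl//; [rewrite ipZl// mulN1r|exact: inL2Z].
by apply/funext => x; rewrite mulN1r.
Qed.

Lemma ipBr f g h : inL2 Om f -> inL2 Om g -> inL2 Om h ->
  ip Om h (fun x => f x - g x) = ip Om h f - ip Om h g.
Proof.
by move=> lf lg lh; rewrite (ipC (inL2B lf lg) lh) ipBl// rmorphB (ipC lf lh) (ipC lg lh).
Qed.

Lemma ipZr c f h : inL2 Om f -> inL2 Om h ->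
  ip Om h (fun x => c * f x) = conjc c * ip Om h f.
Proof. by move=> lf lh; rewrite (ipC (inL2Z c lf) lh) ipZl// rmorphM (ipC lf lh). Qed.

Lemma ip_sum (I : Type) (s : seq I) (P : pred I) (F : I -> 'rV[R]_d -> C) h :
  (forall i, inL2 Om (F i)) -> inL2 Om h ->
  ip Om (fun x => \sum_(i <- s | P i) F i x) h = \sum_(i <- s | P i) ip Om (F i) h.
Proof.
move=> lF lh; elim: s => [|i s IH].
  rewrite (_ : (fun _ => _) = fun x => 0 * h x); first by rewrite ipZl// mul0r big_nil.
  by apply/funext => x; rewrite big_nil mul0r.
rewrite big_cons; have [Pi|nPi] := boolP (P i).
  rewrite (_ : (fun _ => _) = fun x => F i x + \sum_(i <- s | P i) F i x).
    by rewrite ipDl// ?IH//; exact: inL2_sum.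
  by apply/funext => x; rewrite big_cons Pi.
rewrite (_ : (fun _ => _) = fun x => \sum_(i <- s | P i) F i x)//.
by apply/funext => x; rewrite big_cons (negbTE nPi).
Qed.

Lemma eqL2_ip f g h : inL2 Om f -> inL2 Om g -> inL2 Om h -> eqL2 Om f g ->
  ip Om f h = ip Om g h.
Proof.
move=> lf lg lh fg; have [i1 i2] := ip_integrable lf lh; have [j1 j2] := ip_integrable lg lh.
rewrite /ip /Rintegral; congr Complex; congr fine; apply: ae_eq_integral => //.
- exact: measurable_int i1.
- exact: measurable_int j1.
- by apply: filterS fg => x fgx Dx; rewrite /= fgx.
- exact: measurable_int i2.
- exact: measurable_int j2.
- by apply: filterS fg => x fgx Dx; rewrite /= fgx.
Qed.

Lemma Re_ip_ge0 f : 0 <= Re (ip Om f f).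
Proof. by apply: Rintegral_ge0 => x _; rewrite Re_mulJ addr_ge0// -expr2 sqr_ge0. Qed.

Lemma sqr_L2norm f : L2norm Om f ^+ 2 = Re (ip Om f f).
Proof. by rewrite sqr_sqrtr// Re_ip_ge0. Qed.

Lemma L2norm_ge0 f : 0 <= L2norm Om f. Proof. exact: sqrtr_ge0. Qed.

Lemma sqr_L2normB f g : inL2 Om f -> inL2 Om g ->
  L2norm Om (fun x => f x - g x) ^+ 2 =
  L2norm Om f ^+ 2 + L2norm Om g ^+ 2 - 2 * Re (ip Om f g).
Proof.
move=> lf lg; rewrite !sqr_L2norm ipBl//; last exact: inL2B.
rewrite !ipBr// (ipC lf lg) !(Re_add, Re_opp).
by case: (ip Om f g) => a b /=; ring.
Qed.

(** The missing term of the parallelogram law is the squared norm of [f + g], written as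
    [f - (-1) g]. Two functions of norm at most [delta] thus differ by at most [2 delta]. *)
Lemma parallelogram_le f g : inL2 Om f -> inL2 Om g ->
  L2norm Om (fun x => f x - g x) ^+ 2 <= 2 * (L2norm Om f ^+ 2 + L2norm Om g ^+ 2).
Proof.
move=> lf lg; rewrite sqr_L2normB//.
have := Re_ip_ge0 (fun x => f x - (-1) * g x).
have lNg := inL2Z (-1) lg.
rewrite -sqr_L2norm sqr_L2normB// ipZr// !sqr_L2norm ipZl// ipZr//.
rewrite (_ : conjc (-1 : C) = -1); last by rewrite rmorphN rmorph1.
by rewrite !mulN1r opprK Re_opp; lra.
Qed.

Lemma bessel1 f h : inL2 Om f -> inL2 Om h -> ip Om h h = 1 ->
  L2norm Om (fun x => f x - ip Om f h * h x) ^+ 2 =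
  L2norm Om f ^+ 2 - modulus (ip Om f h) ^+ 2.
Proof.
move=> lf lh h1; rewrite sqr_L2normB//; last exact: inL2Z.
rewrite !sqr_L2norm ipZl//; last exact: inL2Z.
rewrite !ipZr// h1 mulr1 sqr_modulus; case: (ip Om f h) => a b.
by rewrite !Re_mul /=; ring.
Qed.

(** Cauchy-Schwarz for a unit vector, read off from the nonnegative left-hand side of [bessel1]. *)
Lemma modulus_ip_le f h : inL2 Om f -> inL2 Om h -> ip Om h h = 1 ->
  modulus (ip Om f h) <= L2norm Om f.
Proof.
move=> lf lh h1; apply: ler_of_sqr; first exact: L2norm_ge0.
by rewrite -subr_ge0 -bessel1// sqr_ge0.
Qed.

Section Basis.
Variable phi : nat -> 'rV[R]_d -> C.
Hypothesis basis : orthonormal_basis Om phi.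

Let lphi n : inL2 Om (phi n). Proof. by have [] := basis. Qed.
Let iphi m n : ip Om (phi m) (phi n) = (m == n)%:R. Proof. by have [] := basis. Qed.

Lemma bessel f n : inL2 Om f ->
  L2norm Om (fun x => f x - \sum_(k < n) ip Om f (phi k) * phi k x) ^+ 2 =
  L2norm Om f ^+ 2 - \sum_(k < n) modulus (ip Om f (phi k)) ^+ 2.
Proof.
move=> lf; elim: n => [|n IH].
  rewrite big_ord0 subr0; congr (L2norm _ _ ^+ 2).
  by apply/funext => x; rewrite big_ord0 subr0.
rewrite big_ord_recr opprD addrA -IH.
pose S x := \sum_(k < n) ip Om f (phi k) * phi k x.
have lS : inL2 Om S by apply: inL2_sum => i; exact: inL2Z.
(* By orthonormality the remainder has the same coefficient on [phi n] as [f], so [bessel1] applied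
   to the remainder splits off the next term. *)
have E : ip Om (fun x => f x - S x) (phi n) = ip Om f (phi n).
  rewrite ipBl// ip_sum//; last by move=> i; exact: inL2Z.
  rewrite big1 ?subr0// => i _; rewrite ipZl// iphi.
  by rewrite (ltn_eqF (ltn_ord i)) mulr0.
rewrite -[in RHS]E -bessel1//; last by rewrite iphi eqxx.
  congr (L2norm _ _ ^+ 2); apply/funext => x.
  by rewrite E big_ord_recr /= opprD addrA.
exact: inL2B.
Qed.

Lemma parseval f : inL2 Om f ->
  \sum_(k < n) modulus (ip Om f (phi k)) ^+ 2 @[n --> \oo] --> L2norm Om f ^+ 2.
Proof.
move=> lf; have [_ _ /(_ f lf) h] := basis.
have := cvgM h h; rewrite mulr0 => /(_ _) h2.
rewrite -[X in _ --> X]subr0.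
rewrite (_ : (fun _ => _) = fun n => L2norm Om f ^+ 2 -
  L2norm Om (fun x => f x - \sum_(k < n) ip Om f (phi k) * phi k x) ^+ 2); last first.
  by apply/funext => n; rewrite bessel// opprB addrC subrK.
by apply: cvgB; [exact: cvg_cst|exact: h2].
Qed.

(** Parseval's sums are compared term by term and the inequality passes to the limit. *)
Lemma L2norm_le_coefficients f g (M : R) : inL2 Om f -> inL2 Om g -> 0 <= M ->
  (forall k, modulus (ip Om f (phi k)) <= M * modulus (ip Om g (phi k))) ->
  L2norm Om f <= M * L2norm Om g.
Proof.
move=> lf lg M0 fg; apply: ler_of_sqr; first by rewrite mulr_ge0// L2norm_ge0.
rewrite exprMn; apply: (ler_cvg_to (parseval lf) (cvgMl_tmp (parseval lg))).
apply: nearW => n; rewrite mulr_sumr ler_sum// => k _.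
by rewrite -exprMn lerXn2r ?nnegrE ?modulus_ge0 ?mulr_ge0 ?modulus_ge0.
Qed.

End Basis.

End SquareIntegrable.

(** * Coefficients of a Bochner integral *)

Section BochnerCoefficient.
Context {R : realType} {d : nat} (Om : set 'rV[R]_d).
Hypothesis openOm : open Om.
Local Notation C := R[i].
Local Notation Re := (@complex.Re R).
Local Notation Im := (@complex.Im R).
Local Notation leb := (@lebesgue_measure R).

(* No measurability is required, the integral of a nonnegative function being a
   supremum over simple functions below it. *)
Lemma ge0_le_integral_nonmeasurable d' (T : measurableType d')
  (mu : {measure set T -> \bar R}) (f g : T -> \bar R) :
  (forall x, (0 <= f x)%E) -> (forall x, (f x <= g x)%E) ->
  (\int[mu]_x f x <= \int[mu]_x g x)%E.
Proof.
move=> f0 fg; rewrite !ge0_integralTE//; last by move=> x; exact: le_trans (fg x).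
apply: le_ereal_sup => _ [h hf <-]; exists h => // x.
exact: le_trans (hf x) (fg x).
Qed.

Lemma integrable_indicator (A : set (measurableTypeR R)) : measurable A ->
  (leb A < +oo)%E -> leb.-integrable [set: R] (fun y => (\1_A y)%:E).
Proof.
move=> mA Aoo; apply/integrableP; split.
  by apply/measurable_EFinP; exact: measurable_indic.
under eq_integral => y _ do rewrite gee0_abs ?lee_fin//.
by rewrite integral_indic// setIT.
Qed.

Section RealPart.
Variable p : C -> R.
Hypothesis pD : forall z w, p (z + w) = p z + p w.
Hypothesis pZ : forall k z, p (k%:C%C * z) = k * p z.
Hypothesis p_le : forall z, `|p z| <= modulus z.

Let p0 : p 0 = 0. Proof. by rewrite -(mul0r (0 : C)) -[X in p (X * _)]/((0 : R)%:C%C) pZ mul0r. Qed.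

Let pB z w : p (z - w) = p z - p w.
Proof.
rewrite pD; congr (_ + _); rewrite -mulN1r.
by rewrite (_ : -1 = (-1 : R)%:C%C :> C) ?pZ ?mulN1r// rmorphN rmorph1.
Qed.

Let p_sum n (F : 'I_n -> C) : p (\sum_i F i) = \sum_i p (F i).
Proof. by apply: (big_morph p pD p0). Qed.

(** Taking a coefficient commutes with the integral of a simple function by linearity. Against a
    unit vector it is bounded by the norm, so both sides are limits of the same sequence [S k]. *)
Lemma is_bochner_ip_part (F : R -> 'rV[R]_d -> C) J phi : is_bochner Om F J ->
  inL2 Om phi -> ip Om phi phi = 1 ->
  leb.-integrable [set: R] (EFin \o (fun y => p (ip Om (F y) phi))) ->
  p (ip Om J phi) = \int[leb]_y p (ip Om (F y) phi).
Proof.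
move=> [lF lJ [s [wf _ sF sJ]]] lphi phi1 ih.
pose h y := p (ip Om (F y) phi).
pose g k y := p (ip Om (simple_eval (s k) y) phi).
pose S k := p (ip Om (simple_integral (s k)) phi).
have ls k y : inL2 Om (simple_eval (s k) y).
  by apply: inL2_sum => // j; apply: inL2Z => //; have [] := wf k j (ltn_ord j).
have lS k : inL2 Om (simple_integral (s k)).
  by apply: inL2_sum => // j; apply: inL2Z => //; have [] := wf k j (ltn_ord j).
have gE k y : g k y = \sum_(j < simple_size (s k))
    \1_(simple_set (s k) j) y * p (ip Om (simple_val (s k) j) phi).
  rewrite /g /simple_eval ip_sum//; last first.
    by move=> j; apply: inL2Z => //; have [] := wf k j (ltn_ord j).
  rewrite p_sum; apply: eq_bigr => j _; have [_ _ lj] := wf k j (ltn_ord j).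
  by rewrite ipZl// pZ.
have SE k : S k = \sum_(j < simple_size (s k))
    fine (leb (simple_set (s k) j)) * p (ip Om (simple_val (s k) j) phi).
  rewrite /S /simple_integral ip_sum//; last first.
    by move=> j; apply: inL2Z => //; have [] := wf k j (ltn_ord j).
  rewrite p_sum; apply: eq_bigr => j _; have [_ _ lj] := wf k j (ltn_ord j).
  by rewrite ipZl// pZ.
pose term k (j : 'I_(simple_size (s k))) y : \bar R :=
  ((p (ip Om (simple_val (s k) j) phi))%:E * (\1_(simple_set (s k) j) y)%:E)%E.
have iterm k j : leb.-integrable [set: R] (@term k j).
  have [mj fj _] := wf k j (ltn_ord j).
  by apply: integrableZl => //; exact: integrable_indicator.
have gterm k y : (g k y)%:E = (\sum_(j < simple_size (s k)) term k j y)%E.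
  by rewrite gE -sumEFin; apply: eq_bigr => j _; rewrite /term -EFinM mulrC.
have ig k : leb.-integrable [set: R] (EFin \o g k).
  rewrite (_ : _ \o _ = fun y => (\sum_(j < simple_size (s k)) term k j y)%E).
    by apply: integrable_sum.
  by apply/funext => y; rewrite /= gterm.
have Sg k : S k = \int[leb]_y g k y.
  rewrite /Rintegral; under eq_integral => y _ do rewrite gterm.
  rewrite integral_sum// SE.
  have E (j : 'I_(simple_size (s k))) : (\int[leb]_y term k j y =
      (fine (leb (simple_set (s k) j)) * p (ip Om (simple_val (s k) j) phi))%:E)%E.
    have [mj fj _] := wf k j (ltn_ord j).
    rewrite integralZl//; last exact: integrable_indicator.
    rewrite integral_indic// setIT EFinM fineK 1?muleC//.
    by rewrite ge0_fin_numE.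
  by rewrite (eq_bigr _ (fun j _ => E j)) sumEFin.
have h1 : S k @[k --> \oo] --> \int[leb]_y h y.
  have i k : leb.-integrable [set: R] (EFin \o (fun y => g k y - h y)).
    rewrite (_ : _ \o _ = ((EFin \o g k) \- (EFin \o h))%E)//.
    exact: integrableB.
  apply: cvg_zero; apply: norm_cvg0.
  rewrite (_ : (fun _ => _) = fun k => `|\int[leb]_y (g k y - h y)|); last first.
    by apply/funext => k; rewrite /= fctE Sg RintegralB.
  suff /fine_cvg : (`|\int[leb]_y (g k y - h y)|)%:E @[k --> \oo] --> (0 : R)%:E by [].
  apply: squeeze_cvge (cvg_cst 0%E) sF; apply: nearW => k.
  rewrite lee_fin normr_ge0/=.
  apply: (@le_trans _ _ (\int[leb]_y `|g k y - h y|)%:E).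
    by rewrite lee_fin le_normr_Rintegral.
  rewrite /Rintegral fineK; last exact: (integrable_fin_num measurableT (integrable_norm (i k))).
  (* The norm of the approximation error is not known to be measurable in [y]. *)
  apply: ge0_le_integral_nonmeasurable => y; first by rewrite lee_fin.
  rewrite lee_fin -pB -ipBl// (le_trans (p_le _))//.
  by apply: modulus_ip_le => //; exact: inL2B.
have h2 : S k @[k --> \oo] --> p (ip Om J phi).
  apply: cvg_zero; apply: norm_cvg0.
  apply: squeeze_cvgr (cvg_cst 0) sJ; apply: nearW => k.
  rewrite normr_ge0/= fctE -pB -ipBl// (le_trans (p_le _))//.
  by apply: modulus_ip_le => //; exact: inL2B.
exact: (cvg_unique _ h2 h1).
Qed.

End RealPart.

Lemma is_bochner_ip (F : R -> 'rV[R]_d -> C) J phi : is_bochner Om F J ->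
  inL2 Om phi -> ip Om phi phi = 1 -> lorentzian (fun y => ip Om (F y) phi) ->
  ip Om J phi = cint (fun y => ip Om (F y) phi).
Proof.
move=> FJ lphi phi1 /lorentzian_integrable[i1 i2].
have ReZ (k : R) (z : C) : Re (k%:C%C * z) = k * Re z by rewrite Re_mul /= mul0r subr0.
have ImZ (k : R) (z : C) : Im (k%:C%C * z) = k * Im z by rewrite Im_mul /= mul0r addr0.
apply/eqP; rewrite eq_complex; apply/andP; split; apply/eqP.
  exact: (is_bochner_ip_part (@Re_add R) ReZ (@abs_Re_le R) FJ).
exact: (is_bochner_ip_part (@Im_add R) ImZ (@abs_Im_le R) FJ).
Qed.

End BochnerCoefficient.

(** * Coefficients of the regularized solution on the eigenfunctions *)

Section SpectralCoefficients.
Context {R : realType} {d : nat} (Om : set 'rV[R]_d).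
Hypothesis openOm : open Om.
Local Notation C := R[i].
Variable G : ('rV[R]_d -> C) -> ('rV[R]_d -> C) -> Prop.
Hypothesis sG : self_adjoint Om G.
Variables (lam : nat -> R) (phi : nat -> 'rV[R]_d -> C).
Hypothesis eig : eigensystem Om G lam phi.

Let basis : orthonormal_basis Om phi. Proof. by have [] := eig. Qed.
Let lphi n : inL2 Om (phi n). Proof. by have [] := basis. Qed.
Let iphi m n : ip Om (phi m) (phi n) = (m == n)%:R. Proof. by have [_ ->] := basis. Qed.

Lemma solves_inL2 z f v : solves G z f v -> inL2 Om v.
Proof. by move=> Gv; have [] := (sG.2 _ _).1 Gv. Qed.

Lemma solves_coefficient z f v k : inL2 Om f -> solves G z f v ->
  (z - (lam k)%:C%C) * ip Om v (phi k) = ip Om f (phi k).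
Proof.
move=> lf Gv; have lv := solves_inL2 Gv.
have Gphi : G (phi k) (fun x => (lam k)%:C%C * phi k x) by have [] := eig.
(* Self-adjointness puts the eigenpair in the graph of the adjoint, which is tested against the pair
   [v], [z v - f]. *)
have [_ _ /(_ _ _ Gv)] := (sG.2 _ _).1 Gphi.
rewrite ipBl//; last exact: inL2Z.
rewrite ipZl// ipZr// conjc_real => E.
by rewrite mulrBl -E opprB addrCA subrr addr0.
Qed.

(** Solving at [z = lam k] with right-hand side [phi k] would give coefficients satisfying
    [0 = 1]. *)
Lemma resolvent_neq_eigenvalue z k : resolvent_set Om G z -> z != (lam k)%:C%C.
Proof.
move=> [M /(_ _ (lphi k))[v [Gv _ _]]]; apply/eqP => zE.
have := solves_coefficient k (lphi k) Gv; rewrite zE subrr mul0r iphi eqxx => /esym/eqP.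
by rewrite oner_eq0.
Qed.

Variables (gam nu sig T c : R).
Hypotheses (nu0 : 0 < nu) (sig0 : 0 < sig) (cE : c = gam - nu).
Hypothesis res : forall y, resolvent_set Om G (hyperbola gam nu sig y).
Variables (u0 : 'rV[R]_d -> C) (u : R -> 'rV[R]_d -> C).
Hypothesis lu0 : inL2 Om u0.
Hypothesis hu : regularized_solution Om G lam phi (hyperbola gam nu sig) T c u0 u.

(** The multiplier of the regularized backward evolution: the exponential, cut off at the vertex of
    the contour. *)
Definition growth t k : C := if lam k < c then (expR (lam k * t))%:C%C else 0.

(** The vertex [gam - nu] is a point of the contour, hence of the resolvent set. The translated
    curve therefore misses 0. *)
Lemma eigenvalue_neq_vertex k : gam - lam k != nu.
Proof.
have := resolvent_neq_eigenvalue k (res 0); apply: contra => /eqP h.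
rewrite /hyperbola expr0n addr0 sqrtr_sqr gtr0_norm// mulr0.
by rewrite -h opprB addrCA subrr addr0.
Qed.

Lemma residue_intE k t : 0 < t ->
  residue_int nu sig (gam - lam k) t =
  if lam k < c then 2%:R * pi%:C%C * 'i%C else 0.
Proof.
move=> t0; have neq := eigenvalue_neq_vertex k.
rewrite residue_int_cst//; case: ifPn => h.
  have lt : nu < gam - lam k by move: h; rewrite cE; lra.
  rewrite residue_int_dlog// cint_dlog//.
  apply/eqP; rewrite eq_complex !Re_mul !Im_mul /=.
  by apply/andP; split; apply/eqP; ring.
apply: residue_int_out => //; rewrite lt_neqAle neq/=.
by move: h; rewrite cE -leNgt; lra.
Qed.

Lemma regularized_solution_pos t k : 0 < t <= T ->
  inL2 Om (u t) /\ ip Om (u t) (phi k) = growth t k * ip Om u0 (phi k).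
Proof.
move=> tT; have t0 : 0 < t by case/andP: tT.
have [[v [Gv /(_ t tT)[J bJ uJ]]] _] := hu.
have lJ : inL2 Om J by have [] := bJ.
have -> : u t = (fun x => (2%:R * pi%:C%C * 'i%C)^-1 * J x) by apply/funext.
split; first exact: inL2Z.
have neq := eigenvalue_neq_vertex k.
(* On [z = lam k + w] the exponential splits as [e^(t lam k) e^(t w)]; [K] collects what is constant
   along the contour. *)
pose K : C := (expR (lam k * t))%:C%C * ip Om u0 (phi k).
have FE y : ip Om (fun x => Complex
      (derive1 (@complex.Re R \o hyperbola gam nu sig) y)
      (derive1 (@complex.Im R \o hyperbola gam nu sig) y) *
      (cexp (hyperbola gam nu sig y * t%:C%C) * v (hyperbola gam nu sig y) x)) (phi k) =
    K * residue_kern nu sig (gam - lam k) t y.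
  have lv := solves_inL2 (Gv y).
  have w0 := hyperbola_neq0 nu0 sig0 neq y.
  have wE : hyperbola gam nu sig y = (lam k)%:C%C + hyperbola (gam - lam k) nu sig y.
    apply/eqP; rewrite eq_complex Re_add Im_add /= add0r eqxx andbT.
    by apply/eqP; ring.
  have vE : ip Om (v (hyperbola gam nu sig y)) (phi k) =
      ip Om u0 (phi k) / hyperbola (gam - lam k) nu sig y.
    rewrite -(solves_coefficient k lu0 (Gv y)) {2}wE.
    by rewrite addrAC subrr add0r mulrC mulKf.
  rewrite derive1_hyperbola// ipZl//; last exact: inL2Z.
  rewrite ipZl// vE {1}wE mulrDl cexpD /residue_kern /K /kern.
  have -> : cexp ((lam k)%:C%C * t%:C%C) = (expR (lam k * t))%:C%C.
    by rewrite /cexp Re_mul Im_mul /= !mul0r !mulr0 subr0 add0r cos0 sin0 mulr1.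
  by ring.
have lres := lorentzian_residue nu0 sig0 neq t0.
have lF : lorentzian (fun y => ip Om (fun x => Complex
      (derive1 (@complex.Re R \o hyperbola gam nu sig) y)
      (derive1 (@complex.Im R \o hyperbola gam nu sig) y) *
      (cexp (hyperbola gam nu sig y * t%:C%C) * v (hyperbola gam nu sig y) x)) (phi k)).
  under eq_fun do rewrite FE.
  split; first by apply: ccontinuousM; [exact: ccontinuous_cst|case: lres].
  case: lres => _ [M hM]; exists (modulus K * M) => y.
  by rewrite modulusM /lorentz -mulrA ler_wpM2l ?modulus_ge0.
rewrite ipZl// (is_bochner_ip openOm bJ)//; last by rewrite iphi eqxx.
under [X in cint X]eq_fun do rewrite FE.
rewrite cintZ// -[cint _]/(residue_int nu sig (gam - lam k) t) residue_intE//.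
rewrite /growth /K; case: ifP => _; last by rewrite !mulr0 mul0r.
rewrite mulrC mulrK// unitfE !mulf_neq0//.
- by rewrite eq_complex /= eqxx andbT gt_eqF// pi_gt0.
- by rewrite eq_complex /= oner_eq0 andbF.
Qed.

Lemma regularized_solution_0 k :
  inL2 Om (u 0) /\ ip Om (u 0) (phi k) = growth 0 k * ip Om u0 (phi k).
Proof.
have [_ [[lu [m [al uE]]] orth]] := hu; split => //.
rewrite /growth mulr0 expR0; case: ifPn => h.
  have low : low_modes Om lam phi c (phi k).
    (* [phi k] is the combination of the first [k + 1] modes whose only nonzero coefficient is the
       last. *)
    split=> //; exists k.+1, (fun j => (j == k)%:R); apply: aeW => x _.
    rewrite big_mkcond (bigD1 ord_max)//= h eqxx mul1r big1 ?addr0// => j jk.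
    case: ifP => // _; rewrite (_ : (j == k :> nat) = false) ?mul0r//.
    by apply: contra_neqF jk => /eqP jk; exact: val_inj.
  have := orth _ low; rewrite ipBl// => /eqP; rewrite subr_eq0 => /eqP <-.
  by rewrite mul1r.
(* A high mode is orthogonal to every low mode, hence to the projection. *)
rewrite (eqL2_ip openOm lu _ (lphi k) uE); last by apply: inL2_sum => // j; exact: inL2Z.
rewrite ip_sum//; last by move=> j; exact: inL2Z.
rewrite mul0r big1// => j lj; rewrite ipZl// iphi.
have -> : (j == k :> nat) = false; last by rewrite mulr0.
by apply: contraNF h => /eqP <-.
Qed.

Lemma regularized_solutionE t k : 0 <= t <= T ->
  inL2 Om (u t) /\ ip Om (u t) (phi k) = growth t k * ip Om u0 (phi k).
Proof.
move=> /andP[]; rewrite le_eqVlt => /predU1P[<- _|t0 tT].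
  exact: regularized_solution_0.
by apply: regularized_solution_pos; rewrite t0.
Qed.

End SpectralCoefficients.

(** * The stability estimate *)

Theorem corollary4p2 (R : realType) (d : nat) (hd : (0 < d)%N)
  (Om : set 'rV[R]_d) (hOm : domain Om)
  (L : coefficients (R := R) (d := d)) (hL : uniformly_elliptic Om L)
  (hLsa : self_adjoint Om (dirichlet_op Om L))
  (lam : nat -> R) (phi : nat -> 'rV[R]_d -> R[i])
  (heig : eigensystem Om (dirichlet_op Om L) lam phi)
  (T : R) (hT : 0 < T)
  (g : 'rV[R]_d -> R[i]) (hg : inL2 Om g)
  (delta K s : R) (hdelta : 0 < delta) (hK : 0 < K) (hs : 0 < s < T)
  (Lambda : R) (hLambda : 0 < Lambda)
  (hroot : Lambda = K + Lambda `^ (s / T))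
  (gam nu sig : R) (hnu : 0 < nu) (hsig : 0 < sig)
  (hres : forall y : R,
     resolvent_set Om (dirichlet_op Om L) (hyperbola gam nu sig y))
  (hvertex : complex.Re (hyperbola gam nu sig 0) = ln Lambda / T)
  (u10 u20 : 'rV[R]_d -> R[i]) (hu10 : inL2 Om u10) (hu20 : inL2 Om u20)
  (u1 u2 : R -> 'rV[R]_d -> R[i])
  (hu1 : regularized_solution Om (dirichlet_op Om L) lam phi
           (hyperbola gam nu sig) T (ln Lambda / T) u10 u1)
  (hu2 : regularized_solution Om (dirichlet_op Om L) lam phi
           (hyperbola gam nu sig) T (ln Lambda / T) u20 u2)
  (hdata1 : L2norm Om (fun x => u10 x - g x) <= delta)
  (hdata2 : L2norm Om (fun x => u20 x - g x) <= delta)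
  (hreg1 : L2norm Om (fun x => u1 T x - u1 s x) <= K * delta)
  (hreg2 : L2norm Om (fun x => u2 T x - u2 s x) <= K * delta) :
  forall t : R, 0 <= t <= T ->
    L2norm Om (fun x => u1 t x - u2 t x) <= 2 * Lambda `^ (t / T) * delta.

Proof.
move=> t tT.
have openOm : open Om by case: hOm.
have cE : ln Lambda / T = gam - nu.
  by rewrite -hvertex /= expr0n addr0 sqrtr_sqr gtr0_norm.
have basis : orthonormal_basis Om phi by case: heig.
have lphi n : inL2 Om (phi n) by case: basis.
have s1 k := regularized_solutionE openOm hLsa heig hnu hsig cE hres hu10 hu1 k tT.
have s2 k := regularized_solutionE openOm hLsa heig hnu hsig cE hres hu20 hu2 k tT.
have [l1 _] := s1 0; have [l2 _] := s2 0.
(* The difference of the data is that of their errors with respect to [g], and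
   [2 (delta^2 + delta^2) = (2 delta)^2]. *)
have d0 : L2norm Om (fun x => u10 x - u20 x) <= 2 * delta.
  apply: ler_of_sqr; first by rewrite mulr_ge0// ltW.
  have := parallelogram_le openOm (inL2B hu10 hg) (inL2B hu20 hg).
  rewrite (_ : (fun x => _ - _ - _) = fun x => u10 x - u20 x); last first.
    by apply/funext => x; ring.
  have := L2norm_ge0 Om (fun x => u10 x - g x).
  have := L2norm_ge0 Om (fun x => u20 x - g x).
  by nra.
rewrite (_ : 2 * _ * _ = Lambda `^ (t / T) * (2 * delta)); last by ring.
apply: (@le_trans _ _ (Lambda `^ (t / T) * L2norm Om (fun x => u10 x - u20 x))); last first.
  by rewrite ler_wpM2l ?powR_ge0.
apply: (L2norm_le_coefficients openOm basis); rewrite ?powR_ge0//.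
- exact: inL2B.
- exact: inL2B.
(* Both solutions have the same multiplier, so the coefficient of their difference is [growth t k]
   times that of the difference of the data. *)
move=> k; rewrite !ipBl// (s1 k).2 (s2 k).2 -mulrBr modulusM.
rewrite ler_wpM2r ?modulus_ge0// /growth; case: ifPn => [lt|_]; last first.
  by rewrite modulusE Normc.normc0 powR_ge0.
rewrite /modulus /= expr0n addr0 sqrtr_sqr ger0_norm ?expR_ge0//.
rewrite /powR (gt_eqF hLambda) ler_expR.
(* For a surviving mode, [lam k < ln Lambda / T] is multiplied by [t >= 0]. *)
have -> : t / T * ln Lambda = ln Lambda / T * t by ring.
by rewrite ler_wpM2r ?(ltW lt)//; case/andP: tT.
Qed.
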